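(* Let $N \ge 3$, let $G$ be a cocompact Kleinian group acting on $\partial\mathbb{H}^N = \mathbb{R}^{N-1}\cup\{\infty\}$, and let $f$ be a homeomorphism of $\partial\mathbb{H}^N$ with $f(\infty)=\infty$. Suppose that in a neighbourhood of $w=\infty$ one has $$f(w) = w + \Phi(w) + o(1) \quad (w\to\infty),$$ where $\Phi:\mathbb{R}^{N-1}\setminus\{0\}\to\mathbb{R}^{N-1}$ is homogeneous of degree zero, is not identically zero, and satisfies $\Phi(w+v) = \Phi(w) + O(\|v\|/\|w\|)$. Then the closed subgroup $\overline{\langle G, f\rangle}$ of $\mathrm{Homeo}(\partial\mathbb{H}^N)$ contains a non-trivial one-parameter subgroup $(f_t)_{t\in\mathbb{R}}$ which is conformally conjugate to a flow of Euclidean translations, i.e. there are a conformal map $\phi$ of $\partial\mathbb{H}^N$ and a vector $c\in\mathbb{R}^{N-1}$, $c\neq 0$, such that $\phi f_t\phi^{-1}(w) = w + tc$ for all $t\in\mathbb{R}$ and $w \in \mathbb{R}^{N-1}$.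
   Context: Upper half-space model: $\mathbb{H}^N=\{(x,t): x\in\mathbb{R}^{N-1}, t>0\}$, with boundary $\partial\mathbb{H}^N=\mathbb{R}^{N-1}\cup\{\infty\}$. A Kleinian group is a discrete group of isometries of $\mathbb{H}^N$; it is cocompact if it acts cocompactly on $\mathbb{H}^N$. It acts on $\partial\mathbb{H}^N$ by conformal maps. A conformal map of $\partial\mathbb{H}^N$ means a M\''obius transformation (boundary value of an isometry of $\mathbb{H}^N$, orientation-preserving or not). $\mathrm{Homeo}(\partial\mathbb{H}^N)$ is the group of homeomorphisms of $\partial\mathbb{H}^N$ with the topology of uniform convergence, and $\overline{\langle G,f\rangle}$ is the closure in it of the subgroup generated by $G$ and $f$. A one-parameter subgroup is a continuous homomorphism $t\mapsto f_t$ from $\mathbb{R}$; it is non-trivial if some $f_t\ne \mathrm{id}$. Homogeneous of degree zero means $\Phi(sw)=\Phi(w)$ for all $s>0$. The condition $\Phi(w+v)=\Phi(w)+O(\|v\|/\|w\|)$ means there is a constant $C$ with $\|\Phi(w+v)-\Phi(w)\|\le C\|v\|/\|w\|$ whenever $w\neq 0$ and $w+v\ne 0$. *)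

(* Defs.v *)
From HB Require Import structures.
From mathcomp Require Import all_boot all_order all_algebra.
From mathcomp Require Import all_classical all_reals all_analysis.

Set Implicit Arguments.
Unset Strict Implicit.
Unset Printing Implicit Defensive.

Import Order.TTheory GRing.Theory Num.Theory.
Import numFieldNormedType.Exports.

Local Open Scope classical_set_scope.
Local Open Scope ring_scope.

(* Throughout, [n] is the dimension of the boundary, so that the hyperbolic
   space under consideration has dimension [n + 1]. *)

(* The Euclidean norm; the library norm on ['rV[R]_n] is the sup norm. *)
Definition enorm (R : realType) (n : nat) (x : 'rV[R]_n) : R :=
  Num.sqrt (\sum_(i < n) x 0 i ^+ 2).

Definition is_perm_group (T : Type) (A : set (T -> T)) : Prop :=
  [/\ A id,
      (forall g h, A g -> A h -> A (g \o h)) &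
      (forall g, A g -> exists h, [/\ A h, cancel g h & cancel h g])].

Definition generated (T : Type) (S : set (T -> T)) : set (T -> T) :=
  smallest (@is_perm_group T) S.

Definition homeomorphism (T : topologicalType) : set (T -> T) :=
  [set h | exists k : T -> T,
    [/\ cancel h k, cancel k h, continuous h & continuous k]].

(* The closure of [A] in the space of homeomorphisms of [T], which carries the
   topology of uniform convergence. *)
Definition homeo_closure (T : uniformType) (A : set (T -> T)) : set (T -> T) :=
  @homeomorphism T `&` closure (A : set {uniform T -> T}).

(* As a type, [halfspace R n] carries the topology induced by [R^n * R], which
   is also the topology of the hyperbolic metric. *)
Definition halfspace (R : realType) (n : nat) : set ('rV[R]_n * R) :=
  [set p | 0 < p.2].
Arguments halfspace : clear implicits.

Definition acosh (R : realType) (x : R) : R := ln (x + Num.sqrt (x ^+ 2 - 1)).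

Definition hdist (R : realType) (n : nat) (p q : halfspace R n) : R :=
  acosh (1 + (enorm ((val p).1 - (val q).1) ^+ 2 + ((val p).2 - (val q).2) ^+ 2)
               / (2 * (val p).2 * (val q).2)).

Definition hyp_isometry (R : realType) (n : nat) :
    set (halfspace R n -> halfspace R n) :=
  [set g | (forall p q, hdist (g p) (g q) = hdist p q) /\
           (forall q, exists p, g p = q)].

(* Discreteness is relative to the compact-open topology of the isometry
   group. *)
Definition kleinian_group (R : realType) (n : nat)
    (G : set (halfspace R n -> halfspace R n)) : Prop :=
  [/\ G `<=` @hyp_isometry R n,
      is_perm_group G &
      G `<=` isolated (G : set {compact-open, halfspace R n -> halfspace R n})].

Definition acts_cocompactly (T : topologicalType) (G : set (T -> T)) : Prop :=
  exists2 K : set T, compact K & \bigcup_(g in G) (g @` K) = setT.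

(* [R^(n+1)] together with a point at infinity [None], with the uniform
   structure of the unit sphere of [R^(n+2)], transported by inverse
   stereographic projection. *)
Definition extended (R : realType) (n : nat) : Type :=
  option ('rV[R]_n * R).

Definition stereo (R : realType) (n : nat) (z : extended R n) :
    'rV[R]_n * R * R :=
  if z is Some (x, t) then
    let q := enorm x ^+ 2 + t ^+ 2 in
    ((2 / (q + 1)) *: x, 2 * t / (q + 1), (q - 1) / (q + 1))
  else (0, 0, 1).

HB.instance Definition _ (R : realType) (n : nat) :=
  Choice.copy (extended R n) (option ('rV[R]_n * R)).
HB.instance Definition _ (R : realType) (n : nat) :=
  PseudoMetric.copy (extended R n) (initial_topology (@stereo R n)).

(* The boundary at infinity [R^n] with a point [None] at infinity, sitting in
   [extended R n] as the closure of [t = 0].  The induced distance is uniformly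
   equivalent to the spherical (chordal) one (the library norm on the target
   of [stereo] is a sup norm); its topology is that of the one-point
   compactification of [R^n]. *)
Definition bdry (R : realType) (n : nat) : Type := option 'rV[R]_n.

Definition bdry_incl (R : realType) (n : nat) (x : bdry R n) : extended R n :=
  omap (fun w : 'rV[R]_n => (w, 0)) x.

HB.instance Definition _ (R : realType) (n : nat) :=
  Choice.copy (bdry R n) (option 'rV[R]_n).
HB.instance Definition _ (R : realType) (n : nat) :=
  PseudoMetric.copy (bdry R n) (initial_topology (@bdry_incl R n)).

Definition half_incl (R : realType) (n : nat) (p : halfspace R n) :
  extended R n := Some (val p).

(* [h] is the boundary value of [g]: for every boundary point [x], [g p] tends
   to [h x] when the point [p] of the half-space tends to [x]. *)
Definition boundary_value (R : realType) (n : nat)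
    (g : halfspace R n -> halfspace R n) (h : bdry R n -> bdry R n) : Prop :=
  forall (x : bdry R n) (U : set (extended R n)), nbhs (bdry_incl (h x)) U ->
  exists2 V : set (extended R n), nbhs (bdry_incl x) V &
    forall p, V (half_incl p) -> U (half_incl (g p)).

Definition boundary_action (R : realType) (n : nat)
    (G : set (halfspace R n -> halfspace R n)) : set (bdry R n -> bdry R n) :=
  [set h | exists2 g, G g & boundary_value g h].

Definition conformal_map (R : realType) (n : nat) :
    set (bdry R n -> bdry R n) := boundary_action (@hyp_isometry R n).

Definition one_parameter_subgroup (R : realType) (T : uniformType)
    (A : set (T -> T)) (F : R -> T -> T) : Prop :=
  [/\ forall t, A (F t),
      forall s t, F (s + t) = F s \o F t &
      continuous (F : R -> {uniform T -> T})].

(* [Phi] is only meaningful away from the origin. *)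
Definition homogeneous_deg0 (R : realType) (n : nat)
    (Phi : 'rV[R]_n -> 'rV[R]_n) : Prop :=
  forall (s : R) (w : 'rV[R]_n), 0 < s -> w != 0 -> Phi (s *: w) = Phi w.

(* Main.v *)
Require Import Defs.
From HB Require Import structures.
From mathcomp Require Import all_boot all_order all_algebra.
From mathcomp Require Import all_classical all_reals all_analysis.
From mathcomp Require Import lra.

(** The idea is to look at [f] near infinity through the group [G]. Far away in
    a direction [u] with [c := Phi u] nonzero, homogeneity and the bound on the
    increments of [Phi] make [f] nearly equal to the translation by [c] on any
    ball of prescribed radius ([almost_translation]). If [S w = a + r w] with
    [a] a large multiple of [u], the conjugate of the iterate [f^m] by [S] is
    then uniformly close, in the chordal metric, to the translation by
    [(m / r) c] ([rescaled_iterates]): far from the origin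
    both maps have bounded displacement and so are chordally close to the
    identity.

    The similarity [S] is not in [G], but [G] is cocompact: some [g] in [G]
    brings the image of the base point under [S] back to a fixed compact set,
    so that the isometry [h := g S] displaces the base point by a bounded amount
    ([renormalization]). The conjugate of [f^m] by [g] lies in the group
    generated by [G] and [f]; it is also the conjugate by [h] of the rescaled
    iterate, which is nearly a translation.
    Let [r] tend to infinity. The isometries [h] accumulate at an isometry with
    boundary value [b], and since [m / r] approximates any time [t], the
    conjugate by [b] of the translation by [t c] is a uniform limit of elements
    of the group ([limit_flow]). This gives the flow, and the conformal map
    is the inverse of [b].

    The geometric input is that hyperbolic isometries are Lipschitz for the
    chordal metric of the closed hemisphere, with a constant that depends only
    on their displacement of the base point ([isometry_lipschitz]). This single
    estimate yields the existence of boundary values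
    ([boundary_value_exists]) and the uniform compactness of isometries of
    bounded displacement ([isometry_limit]), and replaces any classification of
    isometries. *)

Set Implicit Arguments.
Unset Strict Implicit.
Unset Printing Implicit Defensive.

Import Order.TTheory GRing.Theory Num.Theory.
Import numFieldNormedType.Exports.

Local Open Scope classical_set_scope.
Local Open Scope ring_scope.

Local Notation ext := Defs.extended.

(** * Euclidean norms and stereographic coordinates *)

Definition dot (R : realType) (n : nat) (x y : 'rV[R]_n) : R :=
  \sum_(i < n) x 0 i * y 0 i.

Definition sqn (R : realType) (n : nat) (x : 'rV[R]_n) : R := dot x x.

Definition dot3 (R : realType) (n : nat) (u v : 'rV[R]_n * R * R) : R :=
  dot u.1.1 v.1.1 + u.1.2 * v.1.2 + u.2 * v.2.

Definition sqn3 (R : realType) (n : nat) (u : 'rV[R]_n * R * R) : R :=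
  dot3 u u.

Section Euclid.
Variables (R : realType) (n : nat).
Implicit Types (x y : 'rV[R]_n) (u v : 'rV[R]_n * R * R).

Lemma dotC x y : dot x y = dot y x.
Proof. by apply: eq_bigr => i _; rewrite mulrC. Qed.

Lemma dotZl a x y : dot (a *: x) y = a * dot x y.
Proof. by rewrite /dot mulr_sumr; apply: eq_bigr => i _; rewrite mxE mulrA. Qed.

Lemma dotZZ a b x y : dot (a *: x) (b *: y) = a * b * dot x y.
Proof. by rewrite dotZl dotC dotZl dotC mulrA. Qed.

Lemma dot0r x : dot x 0 = 0.
Proof. by rewrite /dot big1// => i _; rewrite mxE mulr0. Qed.

Lemma sqnZ a x : sqn (a *: x) = a ^+ 2 * sqn x.
Proof. by rewrite /sqn dotZZ expr2. Qed.

Lemma sqnB x y : sqn (x - y) = sqn x + sqn y - 2 * dot x y.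
Proof.
rewrite /sqn /dot mulr_sumr -big_split/= -sumrB; apply: eq_bigr => i _.
by rewrite !mxE; lra.
Qed.

Lemma sqn_ge0 x : 0 <= sqn x.
Proof. by apply: sumr_ge0 => i _; rewrite -expr2 sqr_ge0. Qed.

Lemma sqnB_le x y : sqn (x - y) <= 2 * sqn x + 2 * sqn y.
Proof.
rewrite /sqn /dot !mulr_sumr -big_split/=; apply: ler_sum => i _.
by rewrite !mxE; have := sqr_ge0 (x 0 i + y 0 i); lra.
Qed.

Lemma sqr_enorm x : enorm x ^+ 2 = sqn x.
Proof.
rewrite /enorm sqr_sqrtr; last by apply: sumr_ge0 => i _; rewrite sqr_ge0.
by apply: eq_bigr => i _; rewrite expr2.
Qed.

Lemma enorm_ge0 x : 0 <= enorm x. Proof. exact: sqrtr_ge0. Qed.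

Lemma entry_le_norm x i : `|x 0 i| <= `|x|.
Proof.
rewrite [leRHS]/Num.norm /= mx_normrE; apply/bigmax_geP; right => /=.
by exists (0, i).
Qed.

Lemma sqr_norm_le_sqn x : `|x| ^+ 2 <= sqn x.
Proof.
have [->|x0] := eqVneq `|x| 0; first by rewrite expr0n/= sqn_ge0.
have [[i j] /= Hx] := @mx_norm_neq0 _ _ _ x x0.
rewrite [X in X ^+ 2]Hx real_normK ?num_real// ord1 /sqn /dot (bigD1 j)//=.
by rewrite -expr2 lerDl; apply: sumr_ge0 => k _; rewrite -expr2 sqr_ge0.
Qed.

Lemma sqn_le_sqr_norm x : sqn x <= n%:R * `|x| ^+ 2.
Proof.
rewrite -[n in n%:R]card_ord -sum1_card natr_sum mulr_suml; apply: ler_sum => i _.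
rewrite mul1r -expr2 -[leLHS]real_normK ?num_real//.
by rewrite lerXn2r ?nnegrE// entry_le_norm.
Qed.

Lemma norm_le_enorm x : `|x| <= enorm x.
Proof.
by rewrite -(@ler_pXn2r _ 2)// ?nnegrE ?enorm_ge0// sqr_enorm sqr_norm_le_sqn.
Qed.

Lemma enorm_le_norm x : enorm x <= n.+1%:R * `|x|.
Proof.
rewrite -(@ler_pXn2r _ 2)// ?nnegrE ?enorm_ge0 ?mulr_ge0// sqr_enorm.
apply: (le_trans (sqn_le_sqr_norm x)); rewrite exprMn ler_wpM2r ?sqr_ge0//.
by rewrite -natrX ler_nat -mulnn; apply: (leq_trans (leqnSn n)); rewrite leq_pmulr.
Qed.

Lemma sqn3B u v : sqn3 (u - v) = sqn3 u + sqn3 v - 2 * dot3 u v.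
Proof.
rewrite /sqn3 /dot3; have := sqnB u.1.1 v.1.1; rewrite /sqn /= => ->; lra.
Qed.

Lemma sqr_norm_le_sqn3 u : `|u| ^+ 2 <= sqn3 u.
Proof.
have h1 := sqr_norm_le_sqn u.1.1; rewrite /sqn in h1.
have h2 := sqr_ge0 u.1.2; have h3 := sqr_ge0 u.2.
have h0 := sqr_ge0 `|u.1.1|; rewrite /sqn3 /dot3 -!expr2.
rewrite prod_normE; case: (leP `|u.1| `|u.2|) => _.
  by rewrite real_normK ?num_real//; lra.
rewrite prod_normE; case: (leP `|u.1.1| `|u.1.2|) => _; last lra.
by rewrite real_normK ?num_real//; lra.
Qed.

Lemma norm3_ge u : [/\ `|u.1.1| <= `|u|, `|u.1.2| <= `|u| & `|u.2| <= `|u|].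
Proof. by rewrite !prod_normE !le_max !lexx !orbT. Qed.

Lemma sqn3_le_sqr_norm u : sqn3 u <= n.+2%:R * `|u| ^+ 2.
Proof.
have [h1 h2 h3] := norm3_ge u.
have sq (a b : R) : 0 <= a -> a <= b -> a ^+ 2 <= b ^+ 2.
  by move=> a0 ab; rewrite lerXn2r ?nnegrE// (le_trans a0).
have {}h1 := sq _ _ (normr_ge0 _) h1; have {}h2 := sq _ _ (normr_ge0 _) h2.
have {}h3 := sq _ _ (normr_ge0 _) h3.
rewrite (@real_normK _ u.1.2) ?num_real// in h2.
rewrite (@real_normK _ u.2) ?num_real// in h3.
have h := sqn_le_sqr_norm u.1.1.
have := ler_wpM2l (ler0n R n) h1.
rewrite /sqn3 /dot3 -!expr2 -/(sqn _).
rewrite -[in n.+2%:R]addn2 natrD mulrDl; lra.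
Qed.

End Euclid.

Section Stereo.
Variables (R : realType) (n : nat).
Implicit Types (x y : 'rV[R]_n) (z w : ext R n) (p q : halfspace R n).

Lemma inv_uniq (i a : R) : i * a = 1 -> a^-1 = i.
Proof. by rewrite mulrC => /mulr1_eq. Qed.

(** The reciprocal [i] of the denominator is kept as a variable, so that
    identities between stereographic coordinates become polynomial
    consequences of a relation [i * q = 1]. *)
Lemma stereoP x t :
  exists2 i : R, i * (sqn x + t ^+ 2 + 1) = 1 /\ 0 < i &
  stereo (Some (x, t) : ext R n) =
  ((2 * i) *: x, 2 * t * i, (sqn x + t ^+ 2 - 1) * i).
Proof.
have q0 : 0 < sqn x + t ^+ 2 + 1 by have := sqn_ge0 x; have := sqr_ge0 t; lra.
exists (sqn x + t ^+ 2 + 1)^-1.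
  by rewrite invr_gt0 mulVf ?gt_eqF.
by rewrite /stereo /= sqr_enorm.
Qed.

Lemma sqn3_stereo z : sqn3 (stereo z) = 1.
Proof.
case: z => [[x t]|]; last by rewrite /sqn3 /dot3 /= dot0r; lra.
have [i [hi _] ->] := stereoP x t.
rewrite /sqn3 /dot3 /= dotZZ -/(sqn x).
have -> : 2 * i * (2 * i) * sqn x + 2 * t * i * (2 * t * i) +
  (sqn x + t ^+ 2 - 1) * i * ((sqn x + t ^+ 2 - 1) * i) =
  (i * (sqn x + t ^+ 2 + 1)) ^+ 2 by lra.
by rewrite hi expr1n.
Qed.

(** Inverse stereographic projection is conformal, with factor
    [2 / (|z|^2 + 1)]. *)
Lemma chordSS x t y s :
  sqn3 (stereo (Some (x, t) : ext R n) - stereo (Some (y, s) : ext R n)) =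
  4 * (sqn (x - y) + (t - s) ^+ 2) /
    ((sqn x + t ^+ 2 + 1) * (sqn y + s ^+ 2 + 1)).
Proof.
rewrite sqn3B !sqn3_stereo.
have [i [hi i0] ->] := stereoP x t; have [j [hj j0] ->] := stereoP y s.
have -> : ((sqn x + t ^+ 2 + 1) * (sqn y + s ^+ 2 + 1))^-1 = i * j.
  by rewrite invfM (inv_uniq hi) (inv_uniq hj).
rewrite /dot3 /= dotZZ sqnB.
have : (i * (sqn x + t ^+ 2 + 1)) * (j * (sqn y + s ^+ 2 + 1)) = 1.
  by rewrite hi hj mulr1.
lra.
Qed.

Lemma chordSN x t :
  sqn3 (stereo (Some (x, t) : ext R n) - stereo (None : ext R n)) =
  4 / (sqn x + t ^+ 2 + 1).
Proof.
rewrite sqn3B !sqn3_stereo; have [i [hi i0] ->] := stereoP x t.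
rewrite (inv_uniq hi).
by rewrite /dot3 /= dot0r; lra.
Qed.
End Stereo.

(** Limits below are taken along an ultrafilter instead of along successive
    subsequences: compactness then makes all the quantities involved
    converge simultaneously. *)
Lemma fmap_ultra (T U : Type) (k : T -> U) (F : set_system T) :
  UltraFilter F -> UltraFilter (k @ F).
Proof.
move=> FU; split=> [|G GP]; first exact: fmap_proper_filter.
move=>  FG; apply/seteqP; split=> // A GA.
have [//|FA] := in_ultra_setVsetC (k @^-1` A) FU.
by have [x []] := filter_ex (filterI GA (FG (~` A) FA)).
Qed.

Section ExtendedSpace.
Variables (R : realType) (n : nat).
Implicit Types (x y : 'rV[R]_n) (z w : ext R n).

(** The distance that defines the uniform structure. It is built on the sup
    norm of the ambient space; exact computations use [sqn3] instead, and pay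
    a factor depending on the dimension at each conversion. *)
Definition dist z w : R := `|stereo z - stereo w|.

Lemma ball_ext z w (e : R) : ball z e w = (dist z w < e) :> Prop.
Proof. by rewrite [LHS](_ : _ = ball (stereo z) e (stereo w))// -ball_normE. Qed.

Lemma nbhs_extP z (U : set (ext R n)) : nbhs z U <->
  exists2 e : R, 0 < e & forall w, dist z w < e -> U w.
Proof.
rewrite nbhs_ballP; split=> -[e e0 eU]; exists e => // w.
  by rewrite -ball_ext; exact: eU.
by rewrite ball_ext; exact: eU.
Qed.

Lemma dist_ge0 z w : 0 <= dist z w. Proof. exact: normr_ge0. Qed.

Lemma distC z w : dist z w = dist w z. Proof. exact: distrC. Qed.

Lemma distxx z : dist z z = 0. Proof. by rewrite /dist subrr normr0. Qed.

Lemma dist_triangle z1 z2 z3 : dist z1 z3 <= dist z1 z2 + dist z2 z3.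
Proof. exact: ler_distD. Qed.

Lemma sqr_dist_le z w : dist z w ^+ 2 <= sqn3 (stereo z - stereo w).
Proof. exact: sqr_norm_le_sqn3. Qed.

Lemma sqn3_le_dist z w :
  sqn3 (stereo z - stereo w) <= n.+2%:R * dist z w ^+ 2.
Proof. exact: sqn3_le_sqr_norm. Qed.

Lemma sqn_eq0 x : sqn x = 0 -> x = 0.
Proof.
move=> x0; have := sqr_norm_le_sqn x; rewrite x0 => h.
by apply/normr0_eq0/eqP; rewrite -sqrf_eq0 eq_le h sqr_ge0.
Qed.

Lemma dist_eq0 z w : dist z w = 0 -> z = w.
Proof.
move=> zw0; have := sqn3_le_dist z w; rewrite zw0 expr0n/= mulr0 => h.
have q0 x t : 0 < sqn x + t ^+ 2 + 1.
  by have := sqn_ge0 x; have := sqr_ge0 t; lra.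
case: z w {zw0} h => [[x t]|] [[y s]|] //.
- rewrite chordSS pmulr_lle0 ?invr_gt0 ?mulr_gt0// pmulr_rle0// => h.
  have := sqr_ge0 (t - s); have := sqn_ge0 (x - y) => h1 h2.
  have /sqn_eq0/subr0_eq -> : sqn (x - y) = 0 by lra.
  have /eqP : (t - s) ^+ 2 = 0 by lra.
  by rewrite sqrf_eq0 subr_eq0 => /eqP ->.
- by rewrite chordSN pmulr_rle0// invr_le0 leNgt q0.
- rewrite -[_ - _]opprB /sqn3 /dot3 /= -scaleN1r dotZZ !mulrNN !mul1r.
  have := chordSN y s; rewrite /sqn3 /dot3/= => ->.
  by rewrite pmulr_rle0// invr_le0 leNgt q0.
Qed.

(** The preimage is computed by projecting from the north pole [Z = 1]. *)
Lemma stereo_surj (u : 'rV[R]_n * R * R) :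
  sqn3 u = 1 -> exists z : ext R n, stereo z = u.
Proof.
case: u => -[X Y] Z; rewrite /sqn3 /dot3 /= -/(sqn X) => u1.
have [Z1|Z1] := eqVneq Z 1.
  exists None; rewrite Z1 in u1 *.
  have h1 := sqn_ge0 X; have h2 := sqr_ge0 Y.
  have -> : X = 0 by apply: sqn_eq0; lra.
  suff /eqP : Y ^+ 2 = 0 by rewrite sqrf_eq0 => /eqP ->.
  by lra.
have Z0 : 1 - Z != 0 by rewrite subr_eq0 eq_sym.
pose k := (1 - Z)^-1; have hk : k * (1 - Z) = 1 by rewrite mulVf.
exists (Some (k *: X, k * Y)).
have [i [hi i0] ->] := stereoP (k *: X) (k * Y).
rewrite sqnZ in hi *.
have E : k ^+ 2 * sqn X + (k * Y) ^+ 2 = k * (1 + Z).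
  have -> : k ^+ 2 * sqn X + (k * Y) ^+ 2 =
     k * (1 + Z) * (k * (1 - Z)).
     have -> : sqn X = 1 - Y ^+ 2 - Z ^+ 2 by lra.
     by lra.
  by rewrite hk mulr1.
rewrite E in hi *.
have hik : 2 * i * k = 1.
  have e : k * (1 + Z) + 1 = 2 * k by lra.
  by rewrite e in hi; lra.
have h : i * 2 = 1 - Z.
  have -> : i * 2 = (2 * i * k) * (1 - Z).
    by rewrite -mulrA hk mulr1 mulrC.
  by rewrite hik mul1r.
rewrite scalerA hik scale1r.
have -> : 2 * (k * Y) * i = (2 * i * k) * Y by lra.
have -> : (k * (1 + Z) - 1) * i = (2 * i * k) * (1 + Z) / 2 - i by lra.
by rewrite hik mul1r; congr (_, _); lra.
Qed.

Lemma continuous_sqn3 : continuous (fun u : 'rV[R]_n * R * R => sqn3 u).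
Proof.
move=> u.
have c1 : (v.1.1 @[v --> u] --> u.1.1).
  by apply: (@cvg_comp _ _ _ fst fst _ (nbhs u.1)); exact: cvg_fst.
have c2 : (v.1.2 @[v --> u] --> u.1.2).
  by apply: (@cvg_comp _ _ _ fst snd _ (nbhs u.1)); [exact: cvg_fst|exact: cvg_snd].
have c3 : (v.2 @[v --> u] --> u.2) by exact: cvg_snd.
rewrite /sqn3 /dot3 /dot.
apply: cvgD; last exact: cvgM.
apply: cvgD; last exact: cvgM.
apply: cvg_big => [|i _]; first exact: add_continuous.
have c : (fun v : 'rV[R]_n * R * R => v.1.1 0 i) @ u --> u.1.1 0 i.
  exact: (cvg_comp _ _ c1 (@coord_continuous _ _ _ 0 i _)).
exact: cvgM.
Qed.

Lemma sphere_compact : compact [set u : 'rV[R]_n * R * R | sqn3 u = 1].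
Proof.
pose I1 := `[(-1 : R), 1]%classic.
pose B : set ('rV[R]_n * R * R) := ([set x : 'rV[R]_n | `|x| <= 1] `*` I1) `*` I1.
have Bc : compact B.
  apply: compact_setX; last exact: segment_compact.
  apply: compact_setX; last exact: segment_compact.
  have <- : closed_ball_ Num.norm (0 : 'rV[R]_n) 1 = [set x : 'rV[R]_n | `|x| <= 1].
    by apply/seteqP; split=> x; rewrite /closed_ball_/= sub0r normrN.
  apply: bounded_closed_compact; last first.
    by rewrite -closed_ballE//; exact: closed_ball_closed.
  exists 1; split=> // M M1 x; rewrite /closed_ball_/= sub0r normrN => /le_trans; apply.
  exact: ltW.
apply: (subclosed_compact _ Bc).
- have -> : [set u : 'rV[R]_n * R * R | sqn3 u = 1] =
            (@sqn3 R n) @^-1` [set 1] by [].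
  apply: closed_comp; last exact: closed_eq.
  by move=> u _; exact: continuous_sqn3.
- move=> u /= u1; have := sqr_norm_le_sqn3 u; rewrite u1 expr_le1// => h.
  have [h1 h2 h3] := norm3_ge u.
  have {}h1 := le_trans h1 h; have {}h2 := le_trans h2 h; have {}h3 := le_trans h3 h.
  by split; [split|]; rewrite //= /I1/= in_itv/= -ler_norml.
Qed.

Lemma extended_compact : compact [set: ext R n].
Proof.
rewrite compact_ultra => F FU _.
have := sphere_compact; rewrite compact_ultra /=.
move=> /(_ (@stereo R n @ F) _) [||u [/= u1 Fu]].
- exact: fmap_ultra.
- rewrite /fmap/=; apply: (@filterS _ F _ setT) => [z _ /=|]; last exact: filterT.
  exact: sqn3_stereo.
have [z zu] := stereo_surj u1; exists z; split => // U /nbhs_extP[e e0 eU].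
have /cvg_ballP/(_ _ e0) := Fu; apply: filterS => w; rewrite -ball_normE/= => h.
by apply: eU; rewrite /dist zu.
Qed.

Lemma ultra_cvg_ext (T : Type) (F : set_system T) (FU : UltraFilter F)
  (k : T -> ext R n) :
  exists z, forall e : R, 0 < e -> F [set t | dist z (k t) < e].
Proof.
have := extended_compact; rewrite compact_ultra => H.
have [z [_ Fz]] := H _ (fmap_ultra k FU) filterT.
exists z => e e0; apply: (Fz [set w | dist z w < e]).
by apply/nbhs_extP; exists e.
Qed.

End ExtendedSpace.

(** * Chordal distance and hyperbolic isometries *)

Section HalfSpace.
Variables (R : realType) (n : nat).
Implicit Types (x y : 'rV[R]_n) (z w : ext R n) (p q m : halfspace R n).

Definition half_point x (t : R) (t0 : 0 < t) : halfspace R n :=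
  exist _ (x, t) (mem_set t0).

Definition base_point : halfspace R n := half_point 0 ltr01.

Lemma half_gt0 p : 0 < (val p).2.
Proof. exact: (set_valP p). Qed.

Lemma half_eq p q : val p = val q -> p = q.
Proof. exact: val_inj. Qed.

(** The argument of [acosh] in [hdist]. Hyperbolic cosines of distances
    are rational functions of the coordinates, so all metric arguments are
    carried out on them. *)
Definition cosh_dist p q : R :=
  1 + (enorm ((val p).1 - (val q).1) ^+ 2 + ((val p).2 - (val q).2) ^+ 2)
               / (2 * (val p).2 * (val q).2).

Lemma cosh_dist_ge1 p q : 1 <= cosh_dist p q.
Proof.
rewrite lerDl divr_ge0 ?addr_ge0 ?sqr_ge0//.
by rewrite !mulr_ge0// ltW// half_gt0.
Qed.

Lemma cosh_distE p q : cosh_dist p q * (2 * (val p).2 * (val q).2) =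
  sqn ((val p).1 - (val q).1) + (val p).2 ^+ 2 + (val q).2 ^+ 2.
Proof.
rewrite /cosh_dist mulrDl divfK ?sqr_enorm; last first.
  by rewrite !mulf_neq0// gt_eqF// half_gt0.
lra.
Qed.

Lemma sqnBC x y : sqn (x - y) = sqn (y - x).
Proof. by rewrite !sqnB dotC [sqn x + _]addrC. Qed.

Lemma cosh_distC p q : cosh_dist p q = cosh_dist q p.
Proof.
have h : 2 * (val p).2 * (val q).2 != 0 by rewrite !mulf_neq0// gt_eqF// half_gt0.
by apply: (mulIf h); rewrite cosh_distE mulrAC cosh_distE sqnBC; lra.
Qed.

Lemma cosh_dist_eq1 p q : cosh_dist p q = 1 -> p = q.
Proof.
move=> h; have := cosh_distE p q; rewrite h mul1r => e.
have h1 := sqn_ge0 ((val p).1 - (val q).1).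
have h2 := sqr_ge0 ((val p).2 - (val q).2).
apply: half_eq; apply/eqP; rewrite -pair_eqE/=; apply/andP; split.
  by rewrite -subr_eq0; apply/eqP; apply: sqn_eq0; lra.
by rewrite -subr_eq0 -sqrf_eq0; apply/eqP; lra.
Qed.

Lemma cosh_distpp p : cosh_dist p p = 1.
Proof.
by rewrite /cosh_dist !subrr sqr_enorm /sqn dot0r expr0n/= addr0 mul0r addr0.
Qed.

(** The triangle inequality for [hdist] in multiplicative form. The constant
    is not sharp, which is harmless since the bound only serves to produce
    some Lipschitz constant. *)
Lemma cosh_dist_triangle m p q :
  cosh_dist p q <= 4 * cosh_dist p m * cosh_dist m q.
Proof.
have h1 := cosh_distE p q; have h2 := cosh_distE p m; have h3 := cosh_distE m q.
have t0 := half_gt0 p; have s0 := half_gt0 q; have m0 := half_gt0 m.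
have := sqnB_le ((val p).1 - (val m).1) ((val q).1 - (val m).1).
have -> : (val p).1 - (val m).1 - ((val q).1 - (val m).1) =
  (val p).1 - (val q).1 by rewrite opprB addrA subrK.
rewrite (sqnBC (val q).1) => h.
have a0 := sqn_ge0 ((val p).1 - (val m).1).
have b0 := sqn_ge0 ((val m).1 - (val q).1).
have k0 : 0 < (2 * (val p).2 * (val q).2) * (val m).2 ^+ 2.
  by rewrite !mulr_gt0.
rewrite -(ler_pM2r k0).
have -> : 4 * cosh_dist p m * cosh_dist m q *
   (2 * (val p).2 * (val q).2 * (val m).2 ^+ 2) =
   2 * ((cosh_dist p m * (2 * (val p).2 * (val m).2)) *
   (cosh_dist m q * (2 * (val m).2 * (val q).2))) by lra.
rewrite [leLHS]mulrA h1 h2 h3.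
move: h h1 h2 h3 a0 b0 k0 t0 s0 m0.
set c := sqn ((val p).1 - (val q).1); set a := sqn ((val p).1 - (val m).1).
set b := sqn ((val m).1 - (val q).1).
move: c a b (val p).2 (val q).2 (val m).2.
move=> c a b t s r h _ _ _ a0 b0 _ t0 s0 r0.
have A2 : 0 <= (a + t ^+ 2) * (b + s ^+ 2).
  by apply: mulr_ge0; apply: addr_ge0 => //; exact: sqr_ge0.
have r2 := sqr_ge0 r; have r4 := mulr_ge0 r2 r2.
have t2 := sqr_ge0 t; have s2 := sqr_ge0 s.
have := ler_wpM2r r2 h; have := mulr_ge0 r2 t2; have := mulr_ge0 r2 s2.
lra.
Qed.

Lemma acosh_inj (a b : R) : 1 <= a -> 1 <= b -> acosh a = acosh b -> a = b.
Proof.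
suff lt (c d : R) : 1 <= c -> c < d -> acosh c < acosh d.
  move=> a1 b1 ab.
  by case: (ltgtP a b) => // [/(lt _ _ a1)|/(lt _ _ b1)]; rewrite ab ltxx.
move=> c1 cd; rewrite /acosh ltr_ln ?posrE.
- apply: ltr_leD => //; apply: ler_wsqrtr; rewrite lerD2r lerXn2r ?nnegrE; lra.
- by rewrite ltr_pwDl ?sqrtr_ge0//; lra.
- by rewrite ltr_pwDl ?sqrtr_ge0//; lra.
Qed.

Lemma hdist_eqE p q p' q' :
  hdist p q = hdist p' q' <-> cosh_dist p q = cosh_dist p' q'.
Proof.
split; last by rewrite /hdist /cosh_dist => ->.
by apply: acosh_inj; exact: cosh_dist_ge1.
Qed.

(** In the spherical picture the half-space is an open hemisphere, with
    [bdry] as its equator; this coordinate is the one that vanishes there. *)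
Definition height z : R := (stereo z).1.2.

Lemma height_dist z w : `|height z - height w| <= dist z w.
Proof. by have [_ h _] := norm3_ge (stereo z - stereo w). Qed.

Lemma height_bdry (b : bdry R n) : height (bdry_incl b) = 0.
Proof. by case: b => [w|] //; rewrite /height /= mulr0 mul0r. Qed.

(** Approaching the equator amounts to leaving every hyperbolic ball. *)
Lemma height_half p : height (half_incl p) * cosh_dist p base_point = 1.
Proof.
case: p => -[x t] pP; set p := exist _ _ _; have t0 := half_gt0 p.
rewrite /height /half_incl; have [i [hi i0] ->] := stereoP (val p).1 (val p).2.
have := cosh_distE p base_point; rewrite /= subr0 mulr1 in t0 hi * => h.
have := congr1 ( *%R i) h => /= e; lra.
Qed.

Lemma height_half_gt0 p : 0 < height (half_incl p).
Proof.
have := height_half p; have := cosh_dist_ge1 p base_point => h1 h.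
have c0 : 0 < cosh_dist p base_point by lra.
by rewrite -(pmulr_lgt0 _ c0) h.
Qed.

(** The chordal distance is a hyperbolic invariant of the pair, rescaled by
    the heights of the two points. *)
Lemma chord_half p q :
  sqn3 (stereo (half_incl p) - stereo (half_incl q)) =
  2 * (cosh_dist p q - 1) * height (half_incl p) * height (half_incl q).
Proof.
rewrite /height /half_incl sqn3B !sqn3_stereo.
have := cosh_distE p q.
case: p q => -[x t] pP [[y s] qP]; set p := exist _ _ _; set q := exist _ _ _.
have [i [hi i0] ->] := stereoP (val p).1 (val p).2.
have [j [hj j0] ->] := stereoP (val q).1 (val q).2.
rewrite /dot3 /= dotZZ sqnB in hi hj * => h.
have := congr2 *%R hi hj; rewrite mulr1.
have := congr1 ( *%R^~ (i * j)) h => /=.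
lra.
Qed.

End HalfSpace.
Arguments base_point {R n}.

Section Isometries.
Variables (R : realType) (n : nat).
Implicit Types (p q m : halfspace R n) (g : halfspace R n -> halfspace R n).

Lemma isometryP g : hyp_isometry g <->
  (forall p q, cosh_dist (g p) (g q) = cosh_dist p q) /\ forall q, exists p, g p = q.
Proof.
split=> -[h s]; split=> // p q; first exact/hdist_eqE/h.
by apply/hdist_eqE; exact: h.
Qed.

Lemma isometry_cosh g : hyp_isometry g ->
  forall p q, cosh_dist (g p) (g q) = cosh_dist p q.
Proof. by move=> /isometryP[]. Qed.

Lemma isometry_inverse g : hyp_isometry g ->
  exists g', [/\ hyp_isometry g', cancel g g' & cancel g' g].
Proof.
move=> /isometryP[h s].
have [g' gg'] := choice s.
have g'g : cancel g g' by move=> p; apply: cosh_dist_eq1; rewrite -h gg' cosh_distpp.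
exists g'; split => //; apply/isometryP; split=> [p q|q].
  by rewrite -h !gg'.
by exists (g q).
Qed.

Lemma isometry_comp g h : hyp_isometry g -> hyp_isometry h ->
  hyp_isometry (g \o h).
Proof.
move=> [g1 g2] [h1 h2]; split=> [p q|q] /=; first by rewrite g1 h1.
by have [p <-] := g2 q; have [r <-] := h2 p; exists r.
Qed.

(** By the triangle inequality an isometry changes the distance to the base
    point by at most its displacement of that point, hence changes the height
    by a bounded factor. *)
Lemma isometry_height g c p : hyp_isometry g ->
  cosh_dist (g base_point) base_point <= c ->
  height (half_incl (g p)) <= 4 * c * height (half_incl p) /\
  height (half_incl p) <= 4 * c * height (half_incl (g p)).
Proof.
move=> gi gc; have h := isometry_cosh gi.
have a := height_half_gt0 p; have b := height_half_gt0 (g p).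
have ea := height_half p; have eb := height_half (g p).
have h1 := cosh_dist_triangle (g base_point) (g p) base_point.
have h2 := cosh_dist_triangle base_point (g p) (g base_point).
rewrite h in h1; rewrite h (cosh_distC base_point) in h2.
have ab := mulr_gt0 a b.
have p1 := cosh_dist_ge1 p base_point.
have p2 := cosh_dist_ge1 (g p) base_point.
set A := height _ in a ea ab *; set B := height _ in b eb ab *.
set P := cosh_dist p _ in ea p1 h1 h2; set Q := cosh_dist (g p) _ in eb p2 h1 h2.
set k := cosh_dist _ _ in gc h1 h2.
have h1' : Q <= 4 * c * P.
  have P0 : 0 <= 4 * P by lra.
  by have := ler_wpM2l P0 gc; lra.
have h2' : P <= 4 * c * Q.
  have Q0 : 0 <= 4 * Q by lra.
  by have := ler_wpM2l Q0 gc; lra.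
have := ler_wpM2l (ltW ab) h1'; have := ler_wpM2l (ltW ab) h2'.
have -> : A * B * P = B * (A * P) by lra.
have -> : A * B * (4 * c * Q) = 4 * c * A * (B * Q) by lra.
have -> : A * B * Q = A * (B * Q) by lra.
have -> : A * B * (4 * c * P) = 4 * c * B * (A * P) by lra.
by rewrite ea eb; lra.
Qed.

(** In [chord_half] the invariant factor is preserved and, by
    [isometry_height], the other two grow at most by a factor [4 * c]. The
    constant depends on the isometry only through its displacement of the base
    point; this uniformity drives every compactness argument below. *)
Lemma isometry_lipschitz g c p q : hyp_isometry g ->
  cosh_dist (g base_point) base_point <= c ->
  dist (half_incl (g p)) (half_incl (g q)) <=
  4 * c * n.+2%:R * dist (half_incl p) (half_incl q).
Proof.
move=> gi gc; have c1 := le_trans (cosh_dist_ge1 _ _) gc.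
have [hp _] := isometry_height p gi gc; have [hq _] := isometry_height q gi gc.
have n1 : 1 <= n.+2%:R :> R by rewrite ler1n.
have : 0 <= 4 * c by lra.
move: (4 * c) hp hq => l hp hq l0.
rewrite -(@ler_pXn2r _ 2)// ?nnegrE ?mulr_ge0 ?dist_ge0//.
apply: (le_trans (sqr_dist_le _ _)).
rewrite chord_half (isometry_cosh gi).
have := sqn3_le_dist (half_incl p) (half_incl q); rewrite chord_half => h.
have d1 := cosh_dist_ge1 p q.
have := height_half_gt0 (g p); have := height_half_gt0 (g q) => k1 k2.
have := ler_pM (ltW k2) (ltW k1) hp hq.
have d0 : 0 <= 2 * (cosh_dist p q - 1) by lra.
move=> /(ler_wpM2l d0); rewrite mulrA => /le_trans; apply.
have {h} := ler_wpM2l (sqr_ge0 l) h.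
move: (dist _ _) (dist_ge0 (half_incl p) (half_incl q)) => D D0 hh.
have -> : (l * n.+2%:R * D) ^+ 2 = l ^+ 2 * (n.+2%:R * D ^+ 2) * n.+2%:R by lra.
have k0 : 0 <= l ^+ 2 * (n.+2%:R * D ^+ 2) by rewrite !mulr_ge0 ?sqr_ge0.
by have := ler_wpM2l k0 n1; lra.
Qed.

End Isometries.

(** * Boundary values and limits of isometries *)

Section BoundaryValues.
Variables (R : realType) (n : nat).
Implicit Types (p q : halfspace R n) (g h : halfspace R n -> halfspace R n).
Implicit Types (x y : bdry R n) (b : bdry R n -> bdry R n).

Definition bdist x y : R := dist (bdry_incl x) (bdry_incl y).

Lemma bdist_eq0 x y : bdist x y = 0 -> x = y.
Proof. by move=> /dist_eq0; case: x y => [v|] [w|] //= [->]. Qed.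

Lemma bdist_small x y : (forall e : R, 0 < e -> bdist x y <= e) -> x = y.
Proof.
move=> H; apply: bdist_eq0; apply/eqP; rewrite eq_le dist_ge0 andbT.
by apply/ler_addgt0Pl => e /H; rewrite addr0.
Qed.

Lemma boundary_valueP g b : boundary_value g b <->
  forall x (e : R), 0 < e -> exists2 d : R, 0 < d &
    forall p, dist (bdry_incl x) (half_incl p) < d ->
              dist (bdry_incl (b x)) (half_incl (g p)) < e.
Proof.
split=> H x.
  move=> e e0; have [|V /nbhs_extP[d d0 dV] VU] :=
    H x [set w | dist (bdry_incl (b x)) w < e].
    by apply/nbhs_extP; exists e.
  by exists d => // p /dV/VU.
move=> U /nbhs_extP[e e0 eU]; have [d d0 dP] := H x e e0.
exists [set w | dist (bdry_incl x) w < d]; first by apply/nbhs_extP; exists d.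
by move=> p /dP/eU.
Qed.

Lemma dist_vertical (w : 'rV[R]_n) (t : R) (t0 : 0 < t) :
  dist (bdry_incl (Some w)) (half_incl (half_point w t0)) <= 2 * t.
Proof.
have t0' := ltW t0.
rewrite -(@ler_pXn2r _ 2)// ?nnegrE ?dist_ge0 ?mulr_ge0//.
apply: (le_trans (sqr_dist_le _ _)).
rewrite chordSS sqnB /sqn -/(sqn w) sub0r sqrrN.
have w0 := sqn_ge0 w; have t2 := sqr_ge0 t.
have -> : 4 * (sqn w + sqn w - 2 * sqn w + t ^+ 2) = (2 * t) ^+ 2 by lra.
apply: ler_piMr; first exact: sqr_ge0.
rewrite invf_le1 ?expr0n/= ?addr0; have := mulr_ge0 w0 w0; have := mulr_ge0 w0 t2; nra.
Qed.

Lemma dist_vertical_infty (w : 'rV[R]_n) (t : R) (t0 : 0 < t) :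
  dist (bdry_incl None) (half_incl (half_point w t0)) <= 2 / t.
Proof.
have t0' := ltW t0.
rewrite distC -(@ler_pXn2r _ 2)// ?nnegrE ?dist_ge0 ?mulr_ge0 ?invr_ge0//.
apply: (le_trans (sqr_dist_le _ _)); rewrite chordSN exprMn exprVn.
have -> : 2 ^+ 2 = 4 :> R by lra.
have t2 : 0 < t ^+ 2 by rewrite exprn_gt0.
have w0 := sqn_ge0 w.
rewrite ler_pM2l// lef_pV2 ?posrE; lra.
Qed.

Lemma bdry_approx x (d : R) : 0 < d ->
  exists p, dist (bdry_incl x) (half_incl p) < d.
Proof.
move=> d0; case: x => [w|].
  have t0 : 0 < d / 3 by rewrite divr_gt0.
  by exists (half_point w t0); apply: le_lt_trans (dist_vertical _ _) _; lra.
have t0 : 0 < 3 / d by rewrite divr_gt0.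
exists (half_point 0 t0); apply: le_lt_trans (dist_vertical_infty _ _) _.
by rewrite invf_div; lra.
Qed.

(** To compute a boundary value at one point it suffices to follow a single
    curve of the half-space ending there. *)
Lemma boundary_value_at g b x y : boundary_value g b ->
  (forall d : R, 0 < d -> exists2 p, dist (bdry_incl x) (half_incl p) < d &
     dist (bdry_incl y) (half_incl (g p)) < d) -> b x = y.
Proof.
move=> /boundary_valueP gb H; apply: bdist_small => e e0.
have e2 : 0 < e / 2 by rewrite divr_gt0.
have [d d0 dP] := gb x _ e2.
have m0 : 0 < Num.min d (e / 2) by rewrite lt_min d0.
have [p] := H _ m0; rewrite !lt_min => /andP[/dP h1 _] /andP[_ h2].
have := dist_triangle (bdry_incl (b x)) (half_incl (g p)) (bdry_incl y).
rewrite (distC (half_incl _) (bdry_incl y)) /bdist; lra.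
Qed.

Lemma boundary_value_unique g b b' : boundary_value g b ->
  boundary_value g b' -> b = b'.
Proof.
move=> gb /boundary_valueP gb'; apply/funext => x; apply: (boundary_value_at gb).
move=> e e0; have [d d0 dP] := gb' x e e0.
have m0 : 0 < Num.min d e by rewrite lt_min d0.
have [p] := bdry_approx x m0; rewrite lt_min => /andP[h1 h2].
by exists p => //; exact: dP.
Qed.

Lemma boundary_value_comp g h b b' : boundary_value g b ->
  boundary_value h b' -> boundary_value (g \o h) (b \o b').
Proof.
move=> gb hb' x U /gb[V /hb'[W xW WV] VU]; exists W => // p /WV/VU.
exact.
Qed.

Lemma boundary_value_id : boundary_value id (id : bdry R n -> bdry R n).
Proof. by move=> x U xU; exists U. Qed.

Lemma boundary_value_cancel g h b b' : boundary_value g b ->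
  boundary_value h b' -> cancel g h -> cancel b b'.
Proof.
move=> gb hb' gh x.
have /boundary_value_unique E := boundary_value_comp hb' gb.
have gh1 : h \o g = id by apply/funext.
by rewrite gh1 in E; have /(congr1 (@^~ x)) := E _ boundary_value_id.
Qed.

Lemma height_eq0 (z : ext R n) : height z = 0 -> exists x, z = bdry_incl x.
Proof.
case: z => [[w t]|]; last by exists None.
rewrite /height; have [i [_ i0] ->] := stereoP w t => /= /eqP.
rewrite mulf_eq0 (gt_eqF i0) orbF mulf_eq0 pnatr_eq0/= => /eqP ->.
by exists (Some w).
Qed.

(** The images of points approaching [x] accumulate somewhere by
    compactness. Heights tend to zero along the sequence and hence along its
    image, so that the accumulation point lies on the boundary; the Lipschitz
    bound upgrades accumulation to convergence. *)
Lemma boundary_value_exists g : hyp_isometry g -> exists b, boundary_value g b.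
Proof.
move=> gi; pose c := cosh_dist (g base_point) base_point.
have c1 : 1 <= c := cosh_dist_ge1 _ _.
have k1 : 1 <= 4 * c * n.+2%:R.
  by apply: mulr_ege1; [lra|rewrite ler1n].
suff H x : exists y, forall e : R, 0 < e -> exists2 d : R, 0 < d &
    forall p, dist (bdry_incl x) (half_incl p) < d ->
              dist (bdry_incl y) (half_incl (g p)) < e.
  have [b bP] := choice H.
  by exists b; apply/boundary_valueP.
have [p pP] := choice (fun k : nat => @bdry_approx x k.+1%:R^-1 (ltac:(by []))).
have [U [UU oU]] := ultraFilterLemma eventually_filter.
have [z zU] := ultra_cvg_ext UU (fun k => half_incl (g (p k))).
have sel (e : R) : 0 < e ->
    exists k, dist (bdry_incl x) (half_incl (p k)) < e /\
              dist z (half_incl (g (p k))) < e.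
  move=> e0; have h1 := zU e e0.
  have h2 : U [set k : nat | k.+1%:R^-1 < e].
    by apply: oU; exact: near_infty_natSinv_lt (PosNum e0).
  have [k [/= k1' k2]] := filter_ex (filterI h1 h2).
  by exists k; split=> //; apply: lt_trans k2.
have [y zy] : exists y, z = bdry_incl y.
  apply: height_eq0; apply/eqP; rewrite -normr_eq0 eq_le normr_ge0 andbT.
  apply/ler_addgt0Pl => e e0; rewrite addr0.
  have e1 : 0 < e / (4 * c + 1) by rewrite divr_gt0//; lra.
  have [k [h1 h2]] := sel _ e1.
  have [h3 _] := isometry_height (p k) gi (lexx _).
  have h4 := height_dist z (half_incl (g (p k))).
  have h5 := height_dist (bdry_incl x) (half_incl (p k)).
  have h6 := height_half_gt0 (p k); have h7 := height_half_gt0 (g (p k)).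
  rewrite height_bdry sub0r normrN gtr0_norm// in h5.
  have h8 : 4 * c * height (half_incl (p k)) <= 4 * c * (e / (4 * c + 1)).
    rewrite ler_pM2l; lra.
  have := ler_normD (height z - height (half_incl (g (p k))))
    (height (half_incl (g (p k)))).
  rewrite subrK (gtr0_norm h7).
  have : (4 * c + 1) * (e / (4 * c + 1)) = e by rewrite mulrC divfK//; lra.
  rewrite -/c in h3.
  lra.
exists y => e e0; have e1 : 0 < e / (3 * (4 * c * n.+2%:R)).
  by rewrite divr_gt0//; lra.
exists (e / (3 * (4 * c * n.+2%:R))) => // q qx.
have [k [h1 h2]] := sel _ e1.
have h3 := isometry_lipschitz (p k) q gi (lexx _).
rewrite zy in h2.
have h4 := dist_triangle (half_incl (p k)) (bdry_incl x) (half_incl q).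
have h5 := dist_triangle (bdry_incl y) (half_incl (g (p k))) (half_incl (g q)).
rewrite (distC (half_incl _) (bdry_incl x)) in h4.
rewrite -/c in h3.
move: (4 * c * n.+2%:R) k1 e1 qx h1 h2 h3 => K K1 e1 qx h1 h2 h3.
set d := e / _ in e1 qx h1 h2.
have de : 3 * K * d = e by rewrite mulrC divfK//; lra.
have : K * dist (half_incl (p k)) (half_incl q) <= K * (2 * d).
  by rewrite ler_pM2l; lra.
have : d <= K * d by rewrite ler_peMl//; lra.
lra.
Qed.

(** The half-space is dense up to its boundary, so that chordal estimates pass
    to boundary values. The two maps may differ: [e] then measures their
    uniform distance. *)
Lemma boundary_value_le g g' b b' (x x' : bdry R n) (e k : R) :
  boundary_value g b -> boundary_value g' b' -> 0 <= k ->
  (forall p q, dist (half_incl (g p)) (half_incl (g' q)) <=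
     e + k * dist (half_incl p) (half_incl q)) ->
  bdist (b x) (b' x') <= e + k * bdist x x'.
Proof.
move=> /boundary_valueP gb /boundary_valueP gb' k0 H.
apply/ler_addgt0Pl => r r0.
have r1 : 0 < r / (2 + 2 * k) by rewrite divr_gt0//; lra.
have [d d0 dP] := gb x _ r1; have [d' d0' dP'] := gb' x' _ r1.
have m0 : 0 < Num.min d (r / (2 + 2 * k)) by rewrite lt_min d0.
have m0' : 0 < Num.min d' (r / (2 + 2 * k)) by rewrite lt_min d0'.
have [p] := bdry_approx x m0; rewrite lt_min => /andP[/dP h1 h2].
have [q] := bdry_approx x' m0'; rewrite lt_min => /andP[/dP' h3 h4].
have := H p q.
have := dist_triangle (bdry_incl (b x)) (half_incl (g p)) (bdry_incl (b' x')).
have := dist_triangle (half_incl (g p)) (half_incl (g' q)) (bdry_incl (b' x')).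
have := dist_triangle (half_incl p) (bdry_incl x) (half_incl q).
have := dist_triangle (bdry_incl x) (bdry_incl x') (half_incl q).
rewrite (distC (half_incl p) (bdry_incl x)) (distC (half_incl (g' q)) (bdry_incl _)).
rewrite /bdist; set s := r / _ in r1 h1 h2 h3 h4 *.
have se : (2 + 2 * k) * s = r by rewrite mulrC divfK//; lra.
move=> t1 t2 t3 t4 /le_trans.
have : k * dist (half_incl p) (half_incl q) <=
  k * (dist (bdry_incl x) (bdry_incl x') + 2 * s).
  by rewrite ler_wpM2l//; lra.
move=> t5 t6.
have := t6 _ (lexx _); lra.
Qed.

Lemma boundary_value_lipschitz g b c x y : hyp_isometry g ->
  cosh_dist (g base_point) base_point <= c -> boundary_value g b ->
  bdist (b x) (b y) <= 4 * c * n.+2%:R * bdist x y.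
Proof.
move=> gi gc gb; rewrite -[leRHS]add0r; apply: (boundary_value_le x y gb gb).
  have c1 := le_trans (cosh_dist_ge1 _ _) gc.
  by rewrite !mulr_ge0//; lra.
by move=> p q; rewrite add0r; exact: isometry_lipschitz.
Qed.

End BoundaryValues.

Section Limits.
Variables (R : realType) (n : nat).
Implicit Types (p q : halfspace R n).

Lemma stereo_cvg (T : Type) (U : set_system T) (UF : Filter U)
  (k : T -> ext R n) (z : ext R n) :
  (forall e : R, 0 < e -> U [set t | dist z (k t) < e]) ->
  (fun t => stereo (k t)) @ U --> stereo z.
Proof. by move=> H; apply/cvg_ballP => e e0; rewrite -ball_normE; exact: H. Qed.

(** An Arzela-Ascoli argument. Pointwise limits stay in the half-space because
    heights are bounded below, and they preserve the metric because
    [chord_half] expresses it by continuous quantities. Surjectivity comes from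
    the pointwise limit of the inverses. If convergence were not uniform, bad
    points [b j] would accumulate at some [z], and one bad point near [z] would
    contradict the common Lipschitz constant. *)
Lemma isometry_limit (T : Type) (U : set_system T) (UU : UltraFilter U)
  (g : T -> halfspace R n -> halfspace R n) (c : R) :
  (forall j, hyp_isometry (g j)) ->
  (forall j, cosh_dist (g j base_point) base_point <= c) ->
  exists2 h, hyp_isometry h & forall e : R, 0 < e ->
    U [set j | forall p, dist (half_incl (g j p)) (half_incl (h p)) <= e].
Proof.
move=> gi gc.
have [t0 _] := filter_ex (@filterT _ U _).
have c1 : 1 <= c := le_trans (cosh_dist_ge1 _ _) (gc t0).
have lim (f : T -> halfspace R n -> halfspace R n) p :
    (forall j, hyp_isometry (f j)) ->
    (forall j, cosh_dist (f j base_point) base_point <= c) ->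
    exists q, forall e : R, 0 < e ->
      U [set j | dist (half_incl q) (half_incl (f j p)) < e].
  move=> fi fc; have [z zU] := ultra_cvg_ext UU (fun j => half_incl (f j p)).
  have hp := height_half_gt0 p.
  have e0 : 0 < height (half_incl p) / (4 * c) by rewrite divr_gt0//; lra.
  have [j /= hj] := filter_ex (zU _ e0).
  have [_ h1] := isometry_height p (fi j) (fc j).
  have h2 := height_dist z (half_incl (f j p)).
  have z0 : 0 < height z.
    have h3 : height (half_incl p) / (4 * c) <= height (half_incl (f j p)).
      by rewrite ler_pdivrMr; lra.
    by move: h2; rewrite ler_norml => /andP[h2 _]; lra.
  case: z zU z0 {h2 hj} => [[x t]|] zU; last by rewrite /height/= ltxx.
  rewrite /height; have [i [_ i0] ->] := stereoP x t => /=.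
  rewrite pmulr_lgt0// pmulr_rgt0// => t0'.
  by exists (half_point x t0').
have [h hP] := choice (fun p => lim g p gi gc).
have [g' g'P] := choice (fun j => isometry_inverse (gi j)).
have g'i j : hyp_isometry (g' j) by have [] := g'P j.
have g'c j : cosh_dist (g' j base_point) base_point <= c.
  by rewrite -(isometry_cosh (gi j)); have [_ _ ->] := g'P j; rewrite cosh_distC.
have hpos := @height_half_gt0 R n.
have k1 : 1 <= 4 * c * n.+2%:R by apply: mulr_ege1; [lra|rewrite ler1n].
pose K := 4 * c * n.+2%:R.
have hiso p q : cosh_dist (h p) (h q) = cosh_dist p q.
  have hc r : (fun j => stereo (half_incl (g j r))) @ U --> stereo (half_incl (h r)).
    by apply: stereo_cvg; exact: hP.
  have hh r : (fun j => height (half_incl (g j r))) @ U --> height (half_incl (h r)).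
    apply/cvg_ballP => e e0; have := hP r e e0; apply: filterS => j /=.
    by rewrite -ball_normE/=; apply: le_lt_trans; exact: height_dist.
  have L : (fun j => sqn3 (stereo (half_incl (g j p)) - stereo (half_incl (g j q)))) @ U
      --> sqn3 (stereo (half_incl (h p)) - stereo (half_incl (h q))).
    exact: (cvg_comp _ _ (cvgB (hc p) (hc q)) (@continuous_sqn3 R n _)).
  have E : (fun j => sqn3 (stereo (half_incl (g j p)) - stereo (half_incl (g j q)))) =
    (fun j => 2 * (cosh_dist p q - 1) * height (half_incl (g j p)) *
               height (half_incl (g j q))).
    by apply/funext => j; rewrite chord_half isometry_cosh.
  have L2 : (fun j => 2 * (cosh_dist p q - 1) * height (half_incl (g j p)) *
               height (half_incl (g j q))) @ U -->
     2 * (cosh_dist p q - 1) * height (half_incl (h p)) * height (half_incl (h q)).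
    by apply: cvgM; [apply: cvgM; [exact: cvg_cst|exact: hh]|exact: hh].
  rewrite E in L; have := norm_cvg_unique L2 L.
  rewrite chord_half => /(_ _)/(mulIf (lt0r_neq0 (hpos _))) e.
  by have := mulIf (lt0r_neq0 (hpos _)) e; lra.
have hsurj q : exists p, h p = q.
  have [p pP] := lim g' q g'i g'c; exists p.
  suff /dist_eq0 : dist (half_incl (h p)) (half_incl q) = 0.
    by case=> /half_eq.
  apply/eqP; rewrite eq_le dist_ge0 andbT; apply/ler_addgt0Pl => e e0.
  have e1 : 0 < e / (K + 1) by rewrite divr_gt0// /K; lra.
  have [j [/= h1 h2]] := filter_ex (filterI (pP _ e1) (hP p _ e1)).
  have h3 := isometry_lipschitz p (g' j q) (gi j) (gc j).
  have [_ _ g'K] := g'P j; rewrite g'K -/K in h3.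
  have h4 := dist_triangle (half_incl (h p)) (half_incl (g j p)) (half_incl q).
  set d := e / _ in e1 h1 h2; rewrite addr0.
  have de : (K + 1) * d = e by rewrite mulrC divfK// /K; lra.
  have : K * dist (half_incl p) (half_incl (g' j q)) <= K * d.
    by rewrite ler_pM2l ?ltW// /K; lra.
  lra.
have hi : hyp_isometry h by apply/isometryP.
exists h => // e e0.
pose A := [set j | forall p, dist (half_incl (g j p)) (half_incl (h p)) <= e].
have [//|UA] := in_ultra_setVsetC A UU.
have bad j : exists p, ~ A j -> e < dist (half_incl (g j p)) (half_incl (h p)).
  have [Aj|/existsNP[p /negP]] := pselect (A j); first by exists base_point.
  by rewrite -ltNge; exists p.
have [b bP] := choice bad.
pose c' := Num.max c (cosh_dist (h base_point) base_point).
have cc' : c <= c' by rewrite le_max lexx.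
have c'c : cosh_dist (h base_point) base_point <= c' by rewrite le_max lexx orbT.
pose K' := 4 * c' * n.+2%:R.
have k1' : 1 <= K' by apply: mulr_ege1; [lra|rewrite ler1n].
have [z zU] := ultra_cvg_ext UU (fun j => half_incl (b j)).
have e1 : 0 < e / (4 * K' + 1) by rewrite divr_gt0//; lra.
have [j0 /= hj0] := filter_ex (zU _ e1).
have [j [/= Aj [h1 h2]]] := filter_ex (filterI UA (filterI (zU _ e1) (hP (b j0) _ e1))).
have := bP j Aj.
have h3 := isometry_lipschitz (b j) (b j0) (gi j) (le_trans (gc j) cc').
have h4 := isometry_lipschitz (b j0) (b j) hi c'c.
have h5 := dist_triangle (half_incl (b j)) z (half_incl (b j0)).
rewrite (distC _ z) in h5; rewrite (distC (half_incl (b j0))) in h4.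
have h6 := dist_triangle (half_incl (g j (b j))) (half_incl (g j (b j0)))
  (half_incl (h (b j))).
have h7 := dist_triangle (half_incl (g j (b j0))) (half_incl (h (b j0)))
  (half_incl (h (b j))).
rewrite (distC _ (half_incl (h (b j0)))) in h7.
rewrite -/K' in h3 h4; set d := e / _ in e1 h1 h2 hj0.
have de : (4 * K' + 1) * d = e by rewrite mulrC divfK//; lra.
have : K' * dist (half_incl (b j)) (half_incl (b j0)) <= K' * (2 * d).
  by rewrite ler_pM2l//; lra.
lra.
Qed.

End Limits.

(** * Similarities, and the action of the homeomorphism near infinity *)

Section Similarities.
Variables (R : realType) (n : nat).
Implicit Types (a w : 'rV[R]_n) (p : halfspace R n).

Definition similarity a (r : R) (r0 : 0 < r) p : halfspace R n :=
  half_point (a + r *: (val p).1) (mulr_gt0 r0 (half_gt0 p)).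

Definition bdry_similarity a (r : R) : bdry R n -> bdry R n :=
  omap (fun w => a + r *: w).

Lemma similarity_isometry a r (r0 : 0 < r) : hyp_isometry (similarity a r0).
Proof.
apply/isometryP; split=> [p q|q].
  have h : 0 < 2 * (val p).2 * (val q).2 by rewrite !mulr_gt0// half_gt0.
  have h' : 2 * (r * (val p).2) * (r * (val q).2) != 0.
    by rewrite !mulf_neq0// gt_eqF// half_gt0.
  apply: (mulIf h').
  have := cosh_distE (similarity a r0 p) (similarity a r0 q) => /= ->.
  have -> : a + r *: (val p).1 - (a + r *: (val q).1) =
     r *: ((val p).1 - (val q).1).
    by rewrite opprD addrACA subrr add0r scalerBr.
  rewrite sqnZ; have := cosh_distE p q.
  by move/(congr1 ( *%R (r ^+ 2))) => /= e; lra.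
have t0 : 0 < r^-1 * (val q).2 by rewrite mulr_gt0 ?invr_gt0// half_gt0.
exists (half_point (r^-1 *: ((val q).1 - a)) t0); apply: half_eq => /=.
rewrite scalerA mulrA divff ?gt_eqF// scale1r mul1r addrC subrK.
by case: (val q).
Qed.

(** Follow the vertical curve above a finite point; for the point at
    infinity, follow the vertical axis upwards. *)
Lemma similarity_boundary a r (r0 : 0 < r) :
  boundary_value (similarity a r0) (bdry_similarity a r).
Proof.
have [b gb] := boundary_value_exists (similarity_isometry a r0).
suff -> : bdry_similarity a r = b by [].
have simE w t (t0 : 0 < t) : similarity a r0 (half_point w t0) =
    half_point (a + r *: w) (mulr_gt0 r0 t0) by exact: half_eq.
apply/funext => x; apply/esym/(boundary_value_at gb) => d d0.
case: x => [w|].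
  have t0 : 0 < d / (3 * (1 + r)) by rewrite divr_gt0//; lra.
  have te : (3 * (1 + r)) * (d / (3 * (1 + r))) = d by rewrite mulrC divfK//; lra.
  have tr := mulr_gt0 r0 t0.
  exists (half_point w t0); first by apply: le_lt_trans (dist_vertical _ _) _; lra.
  by rewrite simE; apply: le_lt_trans (dist_vertical _ _) _; lra.
have s0 : 0 < r^-1 by rewrite invr_gt0.
move: (s0) simE; set s := r^-1 => {}s0 simE.
have k0 : 0 < d / (3 * (1 + s)) by rewrite divr_gt0//; lra.
have te : (3 * (1 + s)) * (d / (3 * (1 + s))) = d by rewrite mulrC divfK//; lra.
have t0 : 0 < (d / (3 * (1 + s)))^-1 by rewrite invr_gt0.
have tr := mulr_gt0 s0 k0.
exists (half_point 0 t0).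
  by apply: le_lt_trans (dist_vertical_infty _ _) _; rewrite invrK; lra.
rewrite simE; apply: le_lt_trans (dist_vertical_infty _ _) _.
by rewrite invfM invrK -/s; lra.
Qed.

Lemma bdry_similarityK a r : r != 0 ->
  cancel (bdry_similarity a r) (bdry_similarity (- (r^-1 *: a)) r^-1).
Proof.
move=> r0 [w|] //=; rewrite scalerDr addrA addNr add0r scalerA mulVf//.
by rewrite scale1r.
Qed.

Lemma bdry_similarityVK a r : r != 0 ->
  cancel (bdry_similarity (- (r^-1 *: a)) r^-1) (bdry_similarity a r).
Proof.
move=> r0 [w|] //=; rewrite scalerDr scalerN !scalerA divff// !scale1r.
by rewrite addrA subrr add0r.
Qed.

(** Two points at bounded Euclidean distance are chordally close as soon as one
    of them is far away. *)
Lemma bdist_sqr_le w w' : bdist (Some w) (Some w') ^+ 2 * (`|w'| ^+ 2 + 1) <=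
  (2 * n.+1%:R * `|w - w'|) ^+ 2.
Proof.
have h := sqr_dist_le (bdry_incl (Some w)) (bdry_incl (Some w')).
rewrite /= chordSS subrr expr0n/= !addr0 in h.
have a0 := sqn_ge0 w; have b0 := sqn_ge0 w'; have ab := mulr_ge0 a0 b0.
have q0 : 0 < (sqn w + 1) * (sqn w' + 1) by lra.
rewrite ler_pdivlMr// -/(bdist (Some w) (Some w')) in h.
have d0 := sqr_ge0 (bdist (Some w) (Some w')).
have h1 : `|w'| ^+ 2 + 1 <= (sqn w + 1) * (sqn w' + 1).
  by have := sqr_norm_le_sqn w'; lra.
apply: (le_trans (ler_wpM2l d0 h1)); apply: (le_trans h).
apply: (@le_trans _ _ (4 * (n%:R * `|w - w'| ^+ 2))).
  by rewrite ler_pM2l//; exact: sqn_le_sqr_norm.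
rewrite !exprMn; have -> : 2 ^+ 2 = 4 :> R by lra.
rewrite -mulrA ler_pM2l//; apply: ler_wpM2r; first exact: sqr_ge0.
by rewrite -natrX ler_nat -mulnn; apply: (leq_trans (leqnSn n)); rewrite leq_pmulr.
Qed.

Lemma bdist_le_norm w w' : bdist (Some w) (Some w') <= 2 * n.+1%:R * `|w - w'|.
Proof.
rewrite -(@ler_pXn2r _ 2)// ?nnegrE ?dist_ge0 ?mulr_ge0//.
apply: le_trans (bdist_sqr_le w w'); apply: ler_peMr; first exact: sqr_ge0.
by have := sqr_ge0 `|w'|; lra.
Qed.

Lemma bdist_norm_le w w' :
  bdist (Some w) (Some w') * `|w'| <= 2 * n.+1%:R * `|w - w'|.
Proof.
rewrite -(@ler_pXn2r _ 2)// ?nnegrE ?mulr_ge0 ?dist_ge0//.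
apply: le_trans (bdist_sqr_le w w'); rewrite exprMn ler_wpM2l ?sqr_ge0//; lra.
Qed.

Lemma bdist_infty_le w : bdist None (Some w) * `|w| <= 2.
Proof.
rewrite -(@ler_pXn2r _ 2)// ?nnegrE ?mulr_ge0 ?dist_ge0// exprMn.
have := sqr_dist_le (bdry_incl (Some w)) (bdry_incl None).
rewrite /= chordSN distC expr0n/= addr0 => h.
have a0 := sqn_ge0 w; rewrite ler_pdivlMr in h; last by lra.
have := sqr_norm_le_sqn w => h'.
have d0 := sqr_ge0 (bdist None (Some w)).
have := ler_wpM2l d0 h'.
rewrite /bdist/= in d0 h *; lra.
Qed.

Lemma bdist_infty_ge (M : R) : exists2 e : R, 0 < e &
  forall w, `|w| <= M -> e <= bdist None (Some w).
Proof.
have k0 : 0 < n.+2%:R * (n%:R * M ^+ 2 + 1) :> R.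
  have : 0 <= n%:R * M ^+ 2 :> R by rewrite mulr_ge0 ?sqr_ge0.
  by move=> M0; rewrite mulr_gt0//; lra.
exists (Num.sqrt (4 / (n.+2%:R * (n%:R * M ^+ 2 + 1)))).
  by rewrite sqrtr_gt0 divr_gt0.
move=> w wM; rewrite -(@ler_pXn2r _ 2)// ?nnegrE ?sqrtr_ge0 ?dist_ge0//.
rewrite sqr_sqrtr; last by rewrite divr_ge0// ltW.
rewrite ler_pdivrMr//.
have := sqn3_le_dist (bdry_incl (Some w)) (bdry_incl None).
rewrite /= chordSN distC expr0n/= addr0 -/(bdist None (Some w)).
have a0 := sqn_ge0 w; rewrite ler_pdivrMr; last by lra.
move/le_trans; apply.
rewrite -mulrA mulrCA ler_wpM2l ?sqr_ge0// ler_wpM2l// lerD2r.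
apply: (le_trans (sqn_le_sqr_norm w)); rewrite ler_wpM2l// lerXn2r ?nnegrE//.
exact: le_trans wM.
Qed.

End Similarities.

Section Dynamics.
Variables (R : realType) (n : nat).
Variables (f Phi : 'rV[R]_n -> 'rV[R]_n).
Hypothesis f_asympt : forall e : R, 0 < e -> exists M : R,
  forall w, M < `|w| -> `|f w - (w + Phi w)| <= e.
Hypothesis f_bounded : forall M : R, exists M' : R,
  forall w, `|w| <= M -> `|f w| <= M'.
Hypothesis Phi_hom : homogeneous_deg0 Phi.
Variable C : R.
Hypothesis C_ge0 : 0 <= C.
Hypothesis Phi_lip : forall w v : 'rV[R]_n, w != 0 -> w + v != 0 ->
  `|Phi (w + v) - Phi w| <= C * (`|v| / `|w|).
Variable u : 'rV[R]_n.
Hypothesis u_neq0 : u != 0.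

Let u_gt0 : 0 < `|u|. Proof. by rewrite normr_gt0. Qed.

(** Homogeneity brings [w] to the sphere of radius [|u|], where the increment
    of [Phi] from [u] is controlled. *)
Lemma Phi_bounded w : w != 0 -> `|Phi w| <= `|Phi u| + 2 * C.
Proof.
move=> w0; have w1 : 0 < `|w| by rewrite normr_gt0.
have s0 : 0 < `|u| / `|w| by rewrite divr_gt0.
rewrite -(Phi_hom s0 w0); set w' := _ *: w.
have nw : `|w'| = `|u| by rewrite normrZ gtr0_norm// divfK ?gt_eqF.
have w'0 : u + (w' - u) != 0 by rewrite addrC subrK -normr_gt0 nw.
have := Phi_lip u_neq0 w'0; rewrite [u + _]addrC subrK => h.
have h1 : `|w' - u| <= 2 * `|u| by have := ler_normB w' u; rewrite nw; lra.
have h2 : C * (`|w' - u| / `|u|) <= C * 2 by rewrite ler_wpM2l// ler_pdivrMr.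
have := ler_normD (Phi w' - Phi u) (Phi u); rewrite subrK; lra.
Qed.

(** Outside a large ball the expansion of [f] bounds its displacement, because
    [Phi] is bounded; inside the ball both points are bounded. *)
Lemma displacement_bounded : exists2 B : R, 0 <= B & forall w, `|f w - w| <= B.
Proof.
have [M fM] := f_asympt (ltr01 : 0 < 1 :> R).
have [M' fM'] := f_bounded (Num.max M 0).
have P0 : 0 <= `|Phi u| + 2 * C by rewrite addr_ge0// mulr_ge0.
exists (1 + (`|Phi u| + 2 * C) + `|M'| + Num.max M 0).
  have := normr_ge0 M'; have : 0 <= Num.max M 0 by rewrite le_max lexx orbT.
  lra.
move=> w; have M0 : 0 <= Num.max M 0 by rewrite le_max lexx orbT.
have n0 := normr_ge0 M'; have := ler_norm M' => n1.
have [wM|wM] := leP `|w| (Num.max M 0).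
  by have := ler_normB (f w) w; have := fM' w wM; lra.
rewrite gt_max in wM; case/andP: wM => wM; rewrite normr_gt0 => w0.
have := fM w wM; have := Phi_bounded w0.
have := ler_normD (f w - (w + Phi w)) (Phi w).
by rewrite opprD addrA subrK; lra.
Qed.

(** Far out in the direction of [u], homogeneity and the Lipschitz bound freeze
    [Phi] to the constant [Phi u] on balls of any prescribed radius. *)
Lemma almost_translation (S eta : R) : 0 < eta -> exists a : 'rV[R]_n,
  forall z, `|z - a| <= S -> `|f z - z - Phi u| <= eta.
Proof.
move=> eta0; have e2 : 0 < eta / 2 by rewrite divr_gt0.
have [M fM] := f_asympt e2.
(* Far enough for the ball of radius [S] about [a] to avoid both the origin and
   the ball where the expansion of [f] fails; the last term makes the
   increment of [Phi] over that ball at most [eta / 2]. *)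
pose k : R := `|M| + `|S| + 1 + 2 * C * `|S| / eta.
have k1 : 0 <= 2 * C * `|S| / eta by rewrite !mulr_ge0// invr_ge0 ltW.
have nM := normr_ge0 M; have nS := normr_ge0 S.
have k0 : 0 < k by rewrite /k; lra.
have r0 : 0 < k / `|u| by rewrite divr_gt0.
exists ((k / `|u|) *: u) => z; set a := _ *: u => za.
have na : `|a| = k by rewrite normrZ gtr0_norm// divfK// gt_eqF.
have a0 : a != 0 by rewrite -normr_gt0 na.
have Pa : Phi a = Phi u by exact: Phi_hom.
have zn : `|M| + 1 <= `|z|.
  have := ler_normB z (z - a); rewrite opprB addrC subrK na.
  have := ler_norm S; rewrite /k; lra.
have z0 : a + (z - a) != 0 by rewrite addrC subrK -normr_gt0; lra.
have := Phi_lip a0 z0; rewrite [a + _]addrC subrK Pa na => h.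
have h2 : C * (`|z - a| / k) <= eta / 2.
  rewrite mulrA ler_pdivrMr//.
  have : C * `|z - a| <= C * `|S|.
    by rewrite ler_wpM2l//; have := ler_norm S; lra.
  have : eta / 2 * (2 * C * `|S| / eta) = C * `|S|.
    by rewrite [2 * C * _]mulrC -mulrA; have := divfK (lt0r_neq0 eta0) (C * `|S|); lra.
  have : 0 <= eta / 2 * (`|M| + `|S| + 1) by rewrite mulr_ge0//; lra.
  by rewrite /k; lra.
have h3 : M < `|z| by have := ler_norm M; lra.
have := fM z h3.
have := ler_normD (f z - (z + Phi z)) (Phi z - Phi u).
rewrite opprD !addrA subrK; lra.
Qed.

Lemma iter_displacement B m z : (forall w, `|f w - w| <= B) ->
  `|iter m f z - z| <= m%:R * B.
Proof.
move=> fB; elim: m => [|m IH]; first by rewrite subrr normr0 mul0r.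
have := ler_normD (f (iter m f z) - iter m f z) (iter m f z - z).
rewrite addrA subrK /= [m.+1%:R]mulrSr mulrDl mul1r.
by have := fB (iter m f z); lra.
Qed.

(** The increments of [f] along an orbit are summed; the orbit stays in the
    ball of radius [S] since each step has length at most [B]. *)
Lemma iter_almost_translation B S eta (a c z : 'rV[R]_n) m :
  0 <= B -> (forall w, `|f w - w| <= B) ->
  (forall z, `|z - a| <= S -> `|f z - z - c| <= eta) ->
  `|z - a| + m%:R * B <= S -> `|iter m f z - z - m%:R *: c| <= m%:R * eta.
Proof.
move=> B0 fB fc; elim: m => [|m IH] zS.
  by rewrite subrr scale0r subrr normr0 mul0r.
rewrite [m.+1%:R]mulrSr !mulrDl !mul1r scalerDl scale1r in zS *.
have mS : `|z - a| + m%:R * B <= S by lra.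
have h1 := IH mS; have h2 := iter_displacement m z fB.
have h3 := ler_normD (iter m f z - z) (z - a).
rewrite addrA subrK in h3.
have /fc h4 : `|iter m f z - a| <= S by lra.
rewrite /=; set y := iter m f z in h1 h4 *.
have := ler_normD (y - z - m%:R *: c) (f y - y - c).
have -> : y - z - m%:R *: c + (f y - y - c) = f y - z - (m%:R *: c + c).
  by apply/rowP => i; rewrite !mxE; lra.
lra.
Qed.

(** Far from the origin both maps move points by a bounded distance, which is
    negligible in the chordal metric; elsewhere [almost_translation] applies.
    One center [a] serves all the iterates up to [Mx]. *)
Lemma rescaled_iterates (Mx : nat) (r e : R) : 0 < r -> 0 < e ->
  exists a : 'rV[R]_n, forall m w, (m <= Mx)%N ->
    bdist (Some (r^-1 *: (iter m f (a + r *: w) - a)))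
          (Some (w + (m%:R / r) *: Phi u)) <= e.
Proof.
move=> r0 e0; have [B B0 fB] := displacement_bounded.
set c := Phi u.
have N0 : 0 < 2 * n.+1%:R :> R by rewrite mulr_gt0.
move: (2 * n.+1%:R) N0 (@bdist_le_norm R n) (@bdist_norm_le R n) => K K0 bK bK'.
(* [D] bounds how far either map moves a point, and beyond norm [W] this
   displacement has chordal size at most [e]. *)
pose D := Mx%:R / r * (B + `|c|).
have D0 : 0 <= D by rewrite !mulr_ge0 ?invr_ge0 ?addr_ge0// ltW.
pose W := (K * D + 1) / e.
have KD := mulr_ge0 (ltW K0) D0.
have W0 : 0 < W by rewrite divr_gt0//; lra.
(* An error [eta] for each of the [m] steps adds up, after division by [r] and
   conversion to the chordal metric, to at most [e]. *)
pose eta := e * r / (K * (Mx%:R + 1)).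
have M0 : 0 <= Mx%:R :> R by [].
have eta0 : 0 < eta by rewrite divr_gt0 ?mulr_gt0//; lra.
pose S := r * (W + D) + Mx%:R * B.
have [a aP] := almost_translation S eta0.
exists a => m w mM; set z := a + r *: w.
have mM' : m%:R <= Mx%:R :> R by rewrite ler_nat.
have m0 : 0 <= m%:R :> R by [].
set w' := r^-1 *: _; set w2 := w + _.
have rV : 0 <= r^-1 by rewrite invr_ge0 ltW.
have ww' : w' - w2 = r^-1 *: (iter m f z - z - m%:R *: c).
  rewrite /w' /w2 /z opprD !scalerBr scalerDr !scalerA mulVf ?gt_eqF// scale1r.
  by apply/rowP => i; rewrite !mxE; lra.
have wD : `|w2 - w| <= D.
  rewrite /w2 addrC addKr normrZ ger0_norm ?mulr_ge0//.
  rewrite /D; apply: ler_pM => //; first by rewrite mulr_ge0.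
    by rewrite ler_wpM2r.
  by rewrite lerDr.
have w'D : `|w' - w2| <= D.
  rewrite ww' normrZ ger0_norm// /D [_ / r]mulrC -mulrA ler_wpM2l//.
  have := ler_normB (iter m f z - z) (m%:R *: c).
  rewrite normrZ ger0_norm//; have := iter_displacement m z fB.
  have : m%:R * (B + `|c|) <= Mx%:R * (B + `|c|) by rewrite ler_wpM2r// addr_ge0.
  lra.
have [w2W|w2W] := leP W `|w2|.
  have h : bdist (Some w') (Some w2) * W <= e * W.
    have -> : e * W = K * D + 1 by rewrite mulrC divfK// gt_eqF.
    have := ler_wpM2l (dist_ge0 (bdry_incl (Some w')) (bdry_incl (Some w2))) w2W.
    rewrite -/(bdist (Some w') (Some w2)) => h1.
    have := bK' w' w2; have := ler_wpM2l (ltW K0) w'D; lra.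
  by rewrite ler_pM2r in h.
have zS : `|z - a| + m%:R * B <= S.
  have -> : z - a = r *: w by rewrite /z addrC addKr.
  rewrite normrZ gtr0_norm// /S; apply: lerD.
    rewrite ler_pM2l//; have := ler_normB w2 (w2 - w).
    by rewrite subKr; lra.
  by rewrite ler_wpM2r.
have h := iter_almost_translation B0 fB aP zS.
apply: (le_trans (bK _ _)); rewrite ww' normrZ ger0_norm//.
have h1 : K * (r^-1 * `|iter m f z - z - m%:R *: c|) <= K * (r^-1 * (m%:R * eta)).
  by apply: ler_wpM2l; [exact: ltW|exact: ler_wpM2l].
apply: (le_trans h1).
have -> : K * (r^-1 * (m%:R * eta)) = m%:R * (K * eta / r) by lra.
have -> : K * eta / r = e / (Mx%:R + 1).
  rewrite /eta invfM; have := mulfV (lt0r_neq0 K0); have := mulfV (lt0r_neq0 r0) => h2 h3.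
  have -> : K * (e * r * (K^-1 * (Mx%:R + 1)^-1)) / r =
    (K / K) * (r / r) * (e / (Mx%:R + 1)) by lra.
  by rewrite h2 h3 !mul1r.
rewrite mulrA ler_pdivrMr; last by lra.
by have := ler_wpM2r (ltW e0) mM'; lra.
Qed.

End Dynamics.

(** * Uniform approximation and the limit flow *)

Section Uniform.
Variables (R : realType) (n : nat).
Implicit Types (x y : bdry R n) (b F : bdry R n -> bdry R n).

Lemma ball_bdry x y (e : R) : ball x e y = (bdist x y < e) :> Prop.
Proof. exact: (ball_ext (bdry_incl x) (bdry_incl y) e). Qed.

Lemma nbhs_bdryP x (U : set (bdry R n)) : nbhs x U <->
  exists2 e : R, 0 < e & forall y, bdist x y < e -> U y.
Proof.
rewrite nbhs_ballP; split=> -[e e0 eU]; exists e => // y.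
  by rewrite -ball_bdry; exact: eU.
by rewrite ball_bdry; exact: eU.
Qed.

Lemma bdist_le_continuous b (k : R) :
  (forall x y, bdist (b x) (b y) <= k * bdist x y) -> continuous b.
Proof.
move=> bk x U /nbhs_bdryP[e e0 eU]; apply/nbhs_bdryP.
have k0 : 0 < `|k| + 1 by rewrite ltr_wpDl.
exists (e / (`|k| + 1)); first by rewrite divr_gt0.
move=> y; rewrite ltr_pdivlMr// => xy; apply: eU; apply: le_lt_trans (bk x y) _.
have d0 : 0 <= bdist x y := dist_ge0 _ _.
by have := ler_wpM2r d0 (ler_norm k); lra.
Qed.

Lemma nbhs_uniform_bdry (F : {uniform bdry R n -> bdry R n})
    (P : set {uniform bdry R n -> bdry R n}) : nbhs F P <->
  exists2 e : R, 0 < e & forall h : bdry R n -> bdry R n,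
    (forall y, bdist (F y) (h y) < e) -> P h.
Proof.
split.
  move=> /uniform_nbhs[E [entE EP]].
  move: entE; rewrite -entourage_ballE => -[e e0 eE].
  exists e => // h Fh; apply: EP => y _; apply: eE => /=.
  by rewrite ball_bdry.
move=> [e e0 eP]; apply/uniform_nbhs.
exists [set xy : bdry R n * bdry R n | ball xy.1 e xy.2]; split.
  exact: entourage_ball (PosNum e0).
by move=> h /= hP; apply: eP => y; rewrite -ball_bdry; exact: hP.
Qed.

Lemma homeo_closure_approx (A : set (bdry R n -> bdry R n)) F :
  homeomorphism F ->
  (forall e : R, 0 < e -> exists2 a, A a & forall y, bdist (F y) (a y) <= e) ->
  homeo_closure A F.
Proof.
move=> hF FA; split=> // U /nbhs_uniform_bdry[e e0 eU].
have e2 : 0 < e / 2 by rewrite divr_gt0.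
have [a Aa aF] := FA _ e2; exists a; split=> //; apply: eU => y.
by apply: le_lt_trans (aF y) _; lra.
Qed.

End Uniform.

Section PermGroups.
Variables (T : Type) (A : set (T -> T)).
Hypothesis Agrp : is_perm_group A.

(** [is_perm_group] only provides some inverse, but inverses are unique. *)
Lemma perm_group_inverse f k : A f -> cancel f k -> cancel k f -> A k.
Proof.
case: Agrp => _ _ Ainv /Ainv[h [Ah fh hf]] fk kf.
suff -> : k = h by [].
by apply/funext => x; rewrite -[in RHS](kf x) fh.
Qed.

Lemma perm_group_iter f m : A f -> A (iter m f).
Proof.
case: Agrp => A1 AM _ Af; elim: m => [|m IH]; first exact: A1.
exact: (AM f (iter m f)).
Qed.

End PermGroups.

Section CompactSets.
Variables (R : realType) (n : nat).

(** Otherwise a sequence in [K] with unbounded values would have a limit in [K],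
    near which [cosh_dist] is bounded by an explicit constant [c]. *)
Lemma compact_cosh_bounded (K : set (halfspace R n)) : compact K ->
  exists c : R, forall p, K p -> cosh_dist p base_point <= c.
Proof.
move=> Kc; apply: contrapT => /forallNP H.
have bad k : exists p, K p /\ k%:R < cosh_dist p base_point.
  have /existsNP[p] := H k%:R; move=> /not_implyP[Kp /negP].
  by rewrite -ltNge; exists p.
have [p pP] := choice bad.
have [U [UU oU]] := ultraFilterLemma eventually_filter.
move: Kc; rewrite compact_ultra => /(_ _ (fmap_ultra p UU)) [|q [Kq Uq]].
  by apply: (@filterS _ U _ setT) => [j _|]; [have [] := pP j|exact: filterT].
have t0 := half_gt0 q.
have r0 : 0 < Num.min 1 ((val q).2 / 2) by rewrite lt_min ltr01 divr_gt0.
set r := Num.min _ _ in r0.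
have r1 : r <= 1 by rewrite ge_min lexx.
have r2 : r <= (val q).2 / 2 by rewrite ge_min lexx orbT.
have nq : nbhs q [set m : halfspace R n | `|val q - val m| < r].
  have /(_ q) := @initial_continuous _ _ (@set_val _ (halfspace R n)).
  by move=> /cvg_ballP/(_ _ r0); apply: filterS => m; rewrite -ball_normE.
pose c := (n%:R * (`|(val q).1| + 1) ^+ 2 + ((val q).2 + 1) ^+ 2 + 1) / (val q).2.
have hc : U [set j : nat | c < j%:R].
  by apply: oU; exact: nbhs_infty_gtr.
have hq : U [set j | `|val q - val (p j)| < r] := Uq _ nq.
have [j [/= h1 h2]] := filter_ex (filterI hq hc).
have [_ h3] := pP j.
have m0 := half_gt0 (p j).
have := cosh_distE (p j) base_point; rewrite /= subr0 mulr1 expr1n.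
move: h1; rewrite prod_normE gt_max => /andP[h1 h4].
have h5 : `|(val (p j)).1| <= `|(val q).1| + 1.
  have := ler_normB (val q).1 ((val q).1 - (val (p j)).1).
  by rewrite subKr; move: h1 => /=; lra.
have [h6 h7] : (val q).2 <= 2 * (val (p j)).2 /\ (val (p j)).2 <= (val q).2 + 1.
  by move: h4; rewrite /= ltr_norml => /andP[]; lra.
have h8 : sqn (val (p j)).1 <= n%:R * (`|(val q).1| + 1) ^+ 2.
  by apply: (le_trans (sqn_le_sqr_norm _)); rewrite ler_wpM2l// lerXn2r ?nnegrE.
have h9 : (val (p j)).2 ^+ 2 <= ((val q).2 + 1) ^+ 2.
  by rewrite lerXn2r ?nnegrE ?addr_ge0//; exact: ltW.
have h10 : c * (val q).2 = n%:R * (`|(val q).1| + 1) ^+ 2 + ((val q).2 + 1) ^+ 2 + 1.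
  by rewrite divfK// gt_eqF.
have c1 := cosh_dist_ge1 (p j) base_point.
have h11 : cosh_dist (p j) base_point * (val q).2 <=
    cosh_dist (p j) base_point * (2 * (val (p j)).2) by rewrite ler_wpM2l//; lra.
have h12 : c * (val q).2 < cosh_dist (p j) base_point * (val q).2.
  by rewrite ltr_pM2r//; lra.
lra.
Qed.

End CompactSets.

Section LimitFlow.
Variables (R : realType) (n : nat).
Implicit Types (g h : halfspace R n -> halfspace R n).
Implicit Types (x y : bdry R n) (b : bdry R n -> bdry R n).

Definition translation (v : 'rV[R]_n) : bdry R n -> bdry R n :=
  bdry_similarity v 1.

Lemma translationD v w : translation (v + w) = translation v \o translation w.
Proof.
apply/funext => z; rewrite /translation /bdry_similarity; case: z => [x|] //=.
by rewrite !scale1r addrA.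
Qed.

Lemma translation0 : translation 0 = id.
Proof.
apply/funext => z; rewrite /translation /bdry_similarity; case: z => [x|] //=.
by rewrite scale1r add0r.
Qed.

Lemma bdist_translation v w x :
  bdist (translation v x) (translation w x) <= 2 * n.+1%:R * `|v - w|.
Proof.
case: x => [x|] /=; last by rewrite /bdist distxx !mulr_ge0.
apply: (le_trans (bdist_le_norm _ _)).
by rewrite opprD addrACA subrr addr0.
Qed.

Lemma isometry_bdry_lipschitz g b : hyp_isometry g -> boundary_value g b ->
  exists2 k : R, 0 <= k & forall x y, bdist (b x) (b y) <= k * bdist x y.
Proof.
move=> gi gb; exists (4 * cosh_dist (g base_point) base_point * n.+2%:R).
  by rewrite !mulr_ge0//; have := cosh_dist_ge1 (g base_point) base_point; lra.
by move=> x y; exact: (boundary_value_lipschitz x y gi (lexx _) gb).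
Qed.

Lemma isometry_bdry_homeo g b : hyp_isometry g -> boundary_value g b ->
  homeomorphism b.
Proof.
move=> gi gb; have [g' [g'i gg' g'g]] := isometry_inverse gi.
have [b' gb'] := boundary_value_exists g'i.
have [k _ bk] := isometry_bdry_lipschitz gi gb.
have [k' _ bk'] := isometry_bdry_lipschitz g'i gb'.
exists b'; split; [exact: boundary_value_cancel gg'|exact: boundary_value_cancel g'g|..].
- exact: bdist_le_continuous bk.
- exact: bdist_le_continuous bk'.
Qed.

Variables (A : set (bdry R n -> bdry R n)) (c : 'rV[R]_n) (c0 : R).

Hypothesis renormalized : forall (M : nat) (r e : R), 0 < r -> 0 < e ->
  exists h b b', [/\ hyp_isometry h, cosh_dist (h base_point) base_point <= c0
      & boundary_value h b] /\
    [/\ cancel b b', cancel b' b & forall m, (m <= M)%N ->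
      exists E E', [/\ cancel E' E, A (b \o E \o b'), A (b \o E' \o b') &
        forall x, bdist (E x) (translation ((m%:R / r) *: c) x) <= e]].

(** At scale [r = j + 1] the elements [E] approximate the translations by
    [(m / r) *: c], for all [m] up to [r ^ 2]. As [j] grows the multiples of
    [1 / r] become dense, so choosing [m] to be the integer part of [t * r]
    reaches the translation by [t *: c] for every nonnegative [t]. The
    conjugating isometries [h] displace the base point by a bounded amount, so
    along an ultrafilter they converge to one isometry, independent of [t].
    Negative times follow by inversion, which is uniformly continuous at a
    map with Lipschitz inverse. *)
Lemma limit_flow : exists h b b', [/\ hyp_isometry h, boundary_value h b',
  cancel b b', cancel b' b &
  (exists2 k : R, 0 <= k & forall x y, bdist (b x) (b y) <= k * bdist x y) /\
  (forall t, homeo_closure A (b \o translation (t *: c) \o b'))].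
Proof.
pose r (j : nat) : R := j.+1%:R.
have r0 j : 0 < r j by [].
have ri j : 0 < (r j)^-1 by rewrite invr_gt0.
have [h hP] := choice (fun j => renormalized (j.+1 ^ 2) (r0 j) (ri j)).
have [b {}hP] := choice hP; have [b' {}hP] := choice hP.
have [U [UU oU]] := ultraFilterLemma eventually_filter.
have hi j : hyp_isometry (h j) by have [[]] := hP j.
have hc j : cosh_dist (h j base_point) base_point <= c0 by have [[]] := hP j.
have hb j : boundary_value (h j) (b j) by have [[]] := hP j.
have [g gi gU] := isometry_limit UU hi hc.
have [g' [g'i gg' g'g]] := isometry_inverse gi.
have [B gB] := boundary_value_exists gi.
have [B' g'B'] := boundary_value_exists g'i.
have BK := boundary_value_cancel gB g'B' gg'.
have B'K := boundary_value_cancel g'B' gB g'g.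
have [k k0 Bk] := isometry_bdry_lipschitz gi gB.
exists g', B, B'; split=> //; split; first by exists k.
have unif (e : R) : 0 < e -> U [set j | forall x, bdist (B x) (b j x) <= e].
  move=> e0; apply: filterS (gU e e0) => j /= H x.
  rewrite /bdist distC -[leRHS]addr0 -(mul0r (bdist x x)).
  have L : forall p q, dist (half_incl (h j p)) (half_incl (g q)) <=
    e + 4 * c0 * n.+2%:R * dist (half_incl p) (half_incl q).
    move=> p q; have := isometry_lipschitz p q (hi j) (hc j).
    have := dist_triangle (half_incl (h j p)) (half_incl (h j q)) (half_incl (g q)).
    by have := H q; lra.
  have c00 : 0 <= 4 * c0 * n.+2%:R.
    by rewrite !mulr_ge0//; have := le_trans (cosh_dist_ge1 _ _) (hc j); lra.
  have := boundary_value_le x x (hb j) gB c00 L.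
  by rewrite /bdist distxx !mulr0.
have Fbv t : exists2 F', hyp_isometry F' &
    boundary_value F' (B \o translation (t *: c) \o B').
  exists (g \o similarity (t *: c) ltr01 \o g').
    by do 2 apply: isometry_comp => //; exact: similarity_isometry.
  do 2 apply: boundary_value_comp => //; exact: similarity_boundary.
have FD t y : (B \o translation (- t *: c) \o B')
    ((B \o translation (t *: c) \o B') y) = y.
  rewrite /= BK -[translation _ (translation _ _)]/((_ \o _) (B' y)).
  by rewrite -translationD -scalerDl addNr scale0r translation0 B'K.
have core (s e : R) : 0 <= s -> 0 < e -> exists a a', [/\ A a, A a', cancel a' a &
    forall y, bdist ((B \o translation (s *: c) \o B') y) (a y) <= e].
  move=> s0 e0; have [F' F'i F'b] := Fbv s.
  have [l l0 Fl] := isometry_bdry_lipschitz F'i F'b.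
  (* The four terms of [Q] correspond to the four links of the chain from
     [B T B'] to [b j E b' j]: replacing [b j] by [B] inside, rounding [s],
     replacing [T] by [E], and replacing [B] by [b j] outside. *)
  pose Q := l + k * (2 * n.+1%:R * `|c|) + k + 1.
  have kc0 : 0 <= k * (2 * n.+1%:R * `|c|) by rewrite !mulr_ge0.
  have Q0 : 0 < Q by rewrite /Q; lra.
  have e1 : 0 < e / Q by rewrite divr_gt0.
  have u1 := unif _ e1.
  have u2 : U [set j | (r j)^-1 < e / Q].
    by apply: oU; exact: near_infty_natSinv_lt (PosNum e1).
  have u3 : U [set j : nat | s < j%:R] by apply: oU; exact: nbhs_infty_gtr.
  have [j [/= Bb [je sj]]] := filter_ex (filterI u1 (filterI u2 u3)).
  have sr : 0 <= s * r j by rewrite mulr_ge0.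
  pose m := Num.truncn (s * r j).
  have /andP[m1 m2] := Num.Theory.truncn_itv sr.
  have mM : (m <= j.+1 ^ 2)%N.
    rewrite -(ler_nat R); apply: (le_trans m1).
    rewrite natrX expr2 ler_pM2r//; apply: ltW; apply: (lt_le_trans sj).
    by rewrite /r ler_nat.
  have [_ [bK b'K /(_ m mM)[E [E' [EK AE AE' ET]]]]] := hP j.
  exists (b j \o E \o b' j), (b j \o E' \o b' j); split=> // [x|y].
    by rewrite /= bK EK b'K.
  rewrite -[y](b'K y); set x := b' j y; rewrite /= bK.
  have q1 : bdist (B (translation (s *: c) (B' (b j x))))
      (B (translation (s *: c) x)) <= l * (e / Q).
    have := Fl (b j x) (B x); rewrite /= BK => /le_trans; apply.
    by rewrite ler_wpM2l// /bdist distC; exact: Bb.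
  have q2 : bdist (B (translation (s *: c) x))
      (B (translation ((m%:R / r j) *: c) x)) <=
      k * (2 * n.+1%:R * `|c|) * (e / Q).
    apply: (le_trans (Bk _ _)); rewrite -[leRHS]mulrA ler_wpM2l//.
    apply: (le_trans (bdist_translation _ _ _)); rewrite -[leRHS]mulrA ler_wpM2l//.
    rewrite -scalerBl normrZ [`|c| * _]mulrC ler_wpM2r//.
    apply: ltW; apply: le_lt_trans je.
    rewrite ger0_norm; last by rewrite subr_ge0 ler_pdivrMr.
    rewrite lerBlDl -[X in _ + X]mul1r -mulrDl natr1.
    by rewrite ler_pdivlMr//; exact: ltW.
  have q3 : bdist (B (translation ((m%:R / r j) *: c) x)) (B (E x)) <= k * (e / Q).
    apply: (le_trans (Bk _ _)); rewrite ler_wpM2l// /bdist distC.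
    by apply: (le_trans (ET x)); exact: ltW.
  have q4 := Bb (E x).
  have t1 := dist_triangle (bdry_incl (B (translation (s *: c) (B' (b j x)))))
    (bdry_incl (B (translation (s *: c) x))) (bdry_incl (b j (E x))).
  have t2 := dist_triangle (bdry_incl (B (translation (s *: c) x)))
    (bdry_incl (B (translation ((m%:R / r j) *: c) x))) (bdry_incl (b j (E x))).
  have t3 := dist_triangle (bdry_incl (B (translation ((m%:R / r j) *: c) x)))
    (bdry_incl (B (E x))) (bdry_incl (b j (E x))).
  have : Q * (e / Q) = e by rewrite mulrC divfK// gt_eqF.
  rewrite /bdist in q1 q2 q3 q4 *; rewrite {1}/Q; lra.
move=> t; have [F' F'i F'b] := Fbv t.
apply: homeo_closure_approx; first exact: isometry_bdry_homeo F'b.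
have [t0|t0] := leP 0 t.
  by move=> e e0; have [a [a' [Aa _ _ aF]]] := core t e t0 e0; exists a.
have [l l0 Fl] := isometry_bdry_lipschitz F'i F'b.
move=> e e0; have e1 : 0 < e / (l + 1) by rewrite divr_gt0//; lra.
have nt0 : 0 <= - t by lra.
have [a [a' [_ Aa' aa' aF]]] := core _ _ nt0 e1; exists a' => // y.
have := FD (- t) (a' y); rewrite opprK => E.
rewrite -[X in bdist _ X]E -{1}(aa' y).
apply: (le_trans (Fl _ _)); rewrite /bdist distC.
have := ler_wpM2l l0 (aF (a' y)); rewrite /bdist => /le_trans; apply.
by rewrite mulrA ler_pdivrMr; lra.
Qed.

End LimitFlow.

(** * Renormalization by a cocompact group *)

Section Renormalization.
Variables (R : realType) (n : nat).
Variables (G : set (halfspace R n -> halfspace R n)).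
Hypotheses (Giso : G `<=` @hyp_isometry R n) (Ggrp : is_perm_group G).
Hypothesis Gcocompact : acts_cocompactly G.
Variables (f k : bdry R n -> bdry R n) (fh : 'rV[R]_n -> 'rV[R]_n).
Hypotheses (fK : cancel f k) (kK : cancel k f).
Hypothesis f_infty : f None = None.
Hypothesis fE : forall w, f (Some w) = Some (fh w).
Variable c : 'rV[R]_n.
Hypothesis f_rescaled : forall (M : nat) (r e : R), 0 < r -> 0 < e ->
  exists a : 'rV[R]_n, forall m w, (m <= M)%N ->
    bdist (Some (r^-1 *: (iter m fh (a + r *: w) - a)))
          (Some (w + (m%:R / r) *: c)) <= e.

Let Gamma := generated (boundary_action G `|` [set f]).

(** [generated] is an intersection of groups, so membership is checked in each
    group containing the generators. *)
Lemma conjugate_in_generated g h b b' (m : nat) : G g -> G h ->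
  boundary_value g b -> boundary_value h b' ->
  Gamma (b \o iter m f \o b') /\ Gamma (b \o iter m k \o b').
Proof.
move=> Gg Gh gb hb'; split=> A [Agrp SA]; have [_ AM _] := Agrp;
  have Ab : A b by [apply: SA; left; exists g];
  have Ab' : A b' by [apply: SA; left; exists h];
  have Af : A f by [apply: SA; right];
  have Ak := perm_group_inverse Agrp Af fK kK;
  apply: (AM _ _ _ Ab'); apply: (AM _ _ Ab); exact: perm_group_iter.
Qed.

Lemma iter_can m : cancel (iter m k) (iter m f).
Proof.
elim: m => [|m IH] x //.
by rewrite [iter m.+1 k x]iterS iterSr kK IH.
Qed.

(** The similarity [s] may move the base point arbitrarily far; cocompactness
    provides an element [g'] of [G] bringing it back to a fixed compact set. The isometry [g' \o s] then has bounded displacement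
    and conjugates a rescaled iterate of [f] into a conjugate of that iterate
    by an element of [G]. *)
Lemma renormalization : exists c0 : R, forall (M : nat) (r e : R),
  0 < r -> 0 < e ->
  exists h b b', [/\ hyp_isometry h, cosh_dist (h base_point) base_point <= c0
      & boundary_value h b] /\
    [/\ cancel b b', cancel b' b & forall m, (m <= M)%N ->
      exists E E', [/\ cancel E' E, Gamma (b \o E \o b'), Gamma (b \o E' \o b') &
        forall x, bdist (E x) (translation ((m%:R / r) *: c) x) <= e]].
Proof.
have [K Kc KG] := Gcocompact; have [c0 c0P] := compact_cosh_bounded Kc.
exists c0 => M r e r0 e0; have [a aP] := f_rescaled M r0 e0.
pose s := similarity a r0; pose S := bdry_similarity a r.
pose S' := bdry_similarity (- (r^-1 *: a)) r^-1.
have rn0 : r != 0 by rewrite gt_eqF.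
have SK : cancel S S' by exact: bdry_similarityK.
have S'K : cancel S' S by exact: bdry_similarityVK.
have : [set: halfspace R n] (s base_point) by [].
rewrite -KG => -[g Gg [q Kq gq]].
have [_ _ Ginv] := Ggrp; have [g' [Gg' gg' g'g]] := Ginv _ Gg.
have [b gb] := boundary_value_exists (Giso Gg').
have [b' gb'] := boundary_value_exists (Giso Gg).
have bK := boundary_value_cancel gb gb' g'g.
have b'K := boundary_value_cancel gb' gb gg'.
exists (g' \o s), (b \o S), (S' \o b'); split; split.
- by apply: isometry_comp; [exact: Giso|exact: similarity_isometry].
- by rewrite /= -gq gg'; exact: c0P.
- by apply: boundary_value_comp => //; exact: similarity_boundary.
- by move=> x /=; rewrite bK SK.
- by move=> x /=; rewrite S'K b'K.
move=> m mM; exists (S' \o iter m f \o S), (S' \o iter m k \o S).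
have [h1 h2] := conjugate_in_generated m Gg' Gg gb gb'.
split.
- by move=> x /=; rewrite S'K iter_can SK.
- have -> // : (b \o S) \o (S' \o iter m f \o S) \o (S' \o b') =
    b \o iter m f \o b' by apply/funext => x /=; rewrite !S'K.
- have -> // : (b \o S) \o (S' \o iter m k \o S) \o (S' \o b') =
    b \o iter m k \o b' by apply/funext => x /=; rewrite !S'K.
have iterE w : iter m f (Some w) = Some (iter m fh w).
  by elim: (m) => //= i ->; rewrite fE.
have iter_infty : iter m f None = None by elim: (m) => //= i ->.
case=> [w|]; last first.
  by rewrite /= iter_infty /bdist /translation /= distxx ltW.
have := aP m w mM; rewrite /= iterE /translation /= scale1r scalerBr.
by rewrite [- _ + _]addrC [w + _]addrC.
Qed.

End Renormalization.

Section FiniteMap.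
Variables (R : realType) (n : nat).

(** The inverse is continuous at infinity: a point with image close to infinity
    is itself close to infinity. *)
Lemma homeo_finite_bounded (f k : bdry R n -> bdry R n) (fh : 'rV[R]_n -> 'rV[R]_n) :
  cancel f k -> continuous k -> f None = None ->
  (forall w, f (Some w) = Some (fh w)) ->
  forall M : R, exists M' : R, forall w, `|w| <= M -> `|fh w| <= M'.
Proof.
move=> fK kc foo fE M; have koo : k None = None by rewrite -foo fK.
have [e e0 eM] := @bdist_infty_ge R n M.
have : nbhs (k None) [set y | bdist (k None) y < e] by apply/nbhs_bdryP; exists e.
move=> /(kc None)/nbhs_bdryP[d d0 dP]; exists (2 / d) => w wM.
rewrite ler_pdivlMr// mulrC leNgt; apply/negP => h.
have h1 := bdist_infty_le (fh w).
have fw : bdist None (Some (fh w)) < d.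
  rewrite ltNge; apply/negP => dd.
  by have := ler_wpM2r (normr_ge0 (fh w)) dd; lra.
by have := dP _ fw; rewrite /= -fE fK koo ltNge eM.
Qed.

End FiniteMap.

(** * The one-parameter subgroup *)

Theorem theorem1p1 (R : realType) (N : nat) (hN : (3 <= N)%N)
    (G : set (halfspace R N.-1 -> halfspace R N.-1))
    (hG : kleinian_group G) (hGc : acts_cocompactly G)
    (f : bdry R N.-1 -> bdry R N.-1)
    (hf : homeomorphism f) (hfoo : f None = None)
    (Phi : 'rV[R]_N.-1 -> 'rV[R]_N.-1)
    (hfPhi : forall e : R, 0 < e -> exists M : R,
       forall w : 'rV[R]_N.-1, M < enorm w ->
       exists2 u : 'rV[R]_N.-1,
         f (Some w) = Some u & enorm (u - (w + Phi w)) < e)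
    (hPhi_hom : homogeneous_deg0 Phi)
    (hPhi_neq0 : exists2 w : 'rV[R]_N.-1, w != 0 & Phi w != 0)
    (hPhi_O : exists C : R, forall w v : 'rV[R]_N.-1,
       w != 0 -> w + v != 0 ->
       enorm (Phi (w + v) - Phi w) <= C * (enorm v / enorm w)) :
  exists F : R -> bdry R N.-1 -> bdry R N.-1,
    [/\ one_parameter_subgroup
          (homeo_closure (generated (boundary_action G `|` [set f]))) F,
        (exists t : R, F t <> id) &
        exists phi phi_inv : bdry R N.-1 -> bdry R N.-1,
          [/\ conformal_map phi, cancel phi phi_inv, cancel phi_inv phi &
              exists2 c : 'rV[R]_N.-1, c != 0 &
                forall (t : R) (w : 'rV[R]_N.-1),
                  phi (F t (phi_inv (Some w))) = Some (w + t *: c)]].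
Proof.
move: (N.-1) G hG hGc f hf hfoo Phi hfPhi hPhi_hom hPhi_neq0 hPhi_O => n {hN N}.
move=> G [Giso Ggrp _] Gc f [k [fK kK fc kc]] foo Phi f_as Phi_hom [u u0 Phiu0] [C PhiC].
have fin w : exists v, f (Some w) = Some v.
  case E: (f (Some w)) => [v|]; first by exists v.
  by have := fK (Some w); rewrite E -foo fK.
have [fh fE] := choice fin.
pose C' := `|C| * n.+1%:R.
have C'0 : 0 <= C' by rewrite mulr_ge0.
have as' (e : R) : 0 < e -> exists M : R,
    forall w, M < `|w| -> `|fh w - (w + Phi w)| <= e.
  move=> e0; have [M MP] := f_as e e0; exists M => w Mw.
  have [|v] := MP w; first exact: (lt_le_trans Mw (norm_le_enorm w)).
  by rewrite fE => -[<-] /ltW; apply: le_trans; exact: norm_le_enorm.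
have lip' (w v : 'rV[R]_n) : w != 0 -> w + v != 0 ->
    `|Phi (w + v) - Phi w| <= C' * (`|v| / `|w|).
  move=> w0 wv0; apply: (le_trans (norm_le_enorm _)).
  apply: (le_trans (PhiC _ _ w0 wv0)).
  have w1 : 0 < `|w| by rewrite normr_gt0.
  have ew1 : 0 < enorm w := lt_le_trans w1 (norm_le_enorm w).
  apply: (@le_trans _ _ (`|C| * (enorm v / enorm w))).
    by rewrite ler_wpM2r ?ler_norm// divr_ge0// ?enorm_ge0.
  rewrite -mulrA ler_wpM2l// mulrA; apply: ler_pM.
  - exact: enorm_ge0.
  - by rewrite invr_ge0 enorm_ge0.
  - exact: enorm_le_norm.
  - by rewrite lef_pV2 ?posrE// norm_le_enorm.
have bnd := homeo_finite_bounded fK kc foo fE.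
have resc := rescaled_iterates as' bnd Phi_hom C'0 lip' u0.
have [c0 renorm] := renormalization Giso Ggrp Gc fK kK foo fE resc.
have [h [b [b' [hi hb' bK b'K [[l l0 bl] flow]]]]] := limit_flow renorm.
pose F t := b \o translation (t *: Phi u) \o b'.
have FE t x : b' (F t (b x)) = translation (t *: Phi u) x by rewrite /F /= !bK.
exists F; split.
- split=> [t|s t|].
  + exact: flow.
  + apply/funext => y; rewrite /F /= bK.
    by rewrite scalerDl translationD.
  + move=> t U /nbhs_uniform_bdry[e e0 eU].
    have k0 : 0 <= l * (2 * n.+1%:R * `|Phi u|) by rewrite !mulr_ge0.
    have q0 : 0 < e / (l * (2 * n.+1%:R * `|Phi u|) + 1) by rewrite divr_gt0//; lra.
    apply/nbhs_ballP; exists (e / (l * (2 * n.+1%:R * `|Phi u|) + 1)) => //.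
    move=> s; rewrite -ball_normE /= => ts; apply: eU => y.
    apply: (le_lt_trans (bl _ _)).
    have h1 := bdist_translation (t *: Phi u) (s *: Phi u) (b' y).
    apply: (le_lt_trans (ler_wpM2l l0 h1)).
    rewrite -scalerBl normrZ.
    rewrite ltr_pdivlMr in ts; last by lra.
    by have := normr_ge0 (t - s); lra.
- exists 1 => F1; have := FE 1 (Some 0); rewrite F1 /= bK.
  by rewrite !scale1r addr0 => -[] /esym/eqP; rewrite (negPf Phiu0).
- exists b', b; split=> //; first by exists h.
  exists (Phi u) => // t w; rewrite FE /translation /=.
  by rewrite scale1r addrC.
Qed.
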